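(* Let $\mathscr M$ be an (abstract) PET structure over $\mathbb Z$, and let $T\in(\mathscr L^\infty_{\mathbb Z,\mathfrak B})^{\mathscr M}$ be a unitary Leibman sequence (of some degree $d\in\mathbb N$) of operators on the Hilbert space $\mathcal H=\mathcal H^{\mathscr M}$. For every $x\in\mathcal H$, the sequence $(\mathrm{AV}_nT(x):n\in\mathbb N)$ of averages of $x$ under $T$ (indexed by the standard natural numbers) converges in the norm topology of $\mathcal H$.
   Context: Henson structures and logic. A Henson metric structure is a many-sorted structure whose sorts are metric spaces with a distinguished anchor point (one sort being $\mathbb R$), with distinguished constants and distinguished functions between finite products of sorts that are bounded and uniformly continuous on bounded sets; the metrics are among the functions. Positive bounded formulas are built from atomic formulas $t\le r$, $t\ge r$ ($t$ a real-valued term, $r\in\mathbb Q$) by $\wedge,\vee$ and bounded quantifiers $\exists_r x$ (over the closed ball of radius $r$ about the anchor) and $\forall_r x$ (over the open ball of radius $r$). An approximation of $\varphi$ is obtained by strictly relaxing all bounds ($t\le r$ to $t\le r'$ with $r'>r$; $t\ge r$ to $t\ge r'$ with $r'<r$; $\exists_r$ to $\exists_{r'}$ with $r'>r$; $\forall_r$ to $\forall_{r'}$ with $r'<r$). $\mathscr M$ approximately satisfies $\varphi$ if it satisfies every approximation of $\varphi$. The theory of a class of structures is the set of positive bounded sentences approximately satisfied by all its members; a model of a theory is a structure approximately satisfying all its sentences. Classical PET structures over $\mathbb Z$. Let $\mathcal H$ be a real Hilbert space. The sorts are: $\mathbb R,\mathbb N,\mathbb Z$; $\mathcal A_{\mathbb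 Z}$ (all subsets of $\mathbb Z$); $\mathcal H$; $\mathfrak B$ (bounded operators on $\mathcal H$, operator norm); $\mathfrak M$ (finite signed measures $\mu=\sum_i c_i\delta_i$ on $\mathbb Z$, norm $\sum_i|c_i|$); and the Banach spaces $\mathscr L^\infty_{X,Y}$ of bounded functions $X\to Y$ with sup norm, for $X=\mathbb Z$, $Y\in\{\mathbb R,\mathcal H,\mathfrak B,\mathfrak M\}$ and for $X=\mathbb Z^2$, $Y\in\{\mathbb R,\mathcal H,\mathfrak B\}$. The sorts $\mathbb N,\mathbb Z,\mathcal A_{\mathbb Z}$ carry the discrete metric. Below $X,Y$ range over all combinations for which the named sorts exist. Constants: all elements of $\mathbb N$ and $\mathbb Z$; all rationals in $\mathbb R$; the zero of every Banach sort; the identity $I\in\mathfrak B$; $\emptyset,\mathbb Z\in\mathcal A_{\mathbb Z}$. Functions: the discrete metrics; addition, subtraction, multiplication, absolute value, $\min,\max$ on $\mathbb R$; the characteristic function of $\le$ on $\mathbb N$ and of membership on $\mathbb Z\times\mathcal A_{\mathbb Z}$; the group operations of $\mathbb Z$; union, intersection, complement on $\mathcal A_{\mathbb Z}$; vector operations, inner product and norm on $\mathcal H$; addition, scalar multiplication and norm on each Banach sort; the pointwise inner product $\mathscr L^\infty_{X,\mathcal H}\times\mathscr L^\infty_{X,\mathcal H}\to\mathscr L^\infty_{X,\mathbb R}$; pointwise absolute value, $\max$, $\min$ on $\mathscr L^\infty_{X,\mathbb R}$; total variation $|\mu|=\sum_i|c_i|\delta_i$ and coefficientwise $\max,\min$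 on $\mathfrak M$; pointwise norm $\mathscr L^\infty_{X,Y}\to\mathscr L^\infty_{X,\mathbb R}$; adjoint and composition on $\mathfrak B$ and, pointwise, on $\mathscr L^\infty_{X,\mathfrak B}$; the inclusions $\mathbb Z\to\mathcal A_{\mathbb Z}$ ($i\mapsto\{i\}$), $\mathcal A_{\mathbb Z}\to\mathscr L^\infty_{\mathbb Z,\mathbb R}$ ($A\mapsto\chi_A$), $\mathbb Z\to\mathfrak M$ ($i\mapsto\delta_i$), $Y\to\mathscr L^\infty_{X,Y}$ (constant functions), and $\mathscr L^\infty_{\mathbb Z,Y}\to\mathscr L^\infty_{\mathbb Z^2,Y}$ sending $f$ to $(w,x)\mapsto f(x)$, respectively to $(w,x)\mapsto f(w)$; the evaluations $\mathfrak B\times\mathcal H\to\mathcal H$, $\mathscr L^\infty_{X,Y}\times X\to Y$, and pointwise $\mathscr L^\infty_{X,\mathfrak B}\times\mathscr L^\infty_{X,\mathcal H}\to\mathscr L^\infty_{X,\mathcal H}$; the partial evaluations $(F,i)\mapsto F(i,\cdot)$ and $(F,j)\mapsto F(\cdot,j)$ from $\mathscr L^\infty_{\mathbb Z^2,Y}\times\mathbb Z$ to $\mathscr L^\infty_{\mathbb Z,Y}$; the map $\sigma:\mathbb N\to\mathfrak M$, $\sigma_n=\frac1{n+1}\sum_{0\le i\le n}\delta_i$; the translation action $\mathscr L^\infty_{\mathbb Z,Y}\to\mathscr L^\infty_{\mathbb Z^2,Y}$, $f\mapsto((i,j)\mapsto f(i+j))$, with ${}_if$ denoting $j\mapsto f(i+j)$;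 the shear $F\mapsto((i,j)\mapsto F(i,i+j))$ and the swap $F\mapsto((i,j)\mapsto F(j,i))$ on $\mathscr L^\infty_{\mathbb Z^2,Y}$; the translation action $\mathfrak M\to\mathscr L^\infty_{\mathbb Z,\mathfrak M}$, $\mu\mapsto(i\mapsto{}_i\mu)$, where ${}_i\mu=\sum_jc_j\delta_{j-i}$ for $\mu=\sum_jc_j\delta_j$; and the integrations, for $\mu=\sum_i c_i\delta_i$: $(f,\mu)\mapsto\langle f,\mu\rangle=\sum_ic_if(i)$ from $\mathscr L^\infty_{\mathbb Z,Y}\times\mathfrak M$ to $Y$; $(\mu,F)\mapsto(j\mapsto\langle F(\cdot,j),\mu\rangle)$ and $(F,\mu)\mapsto(i\mapsto\langle F(i,\cdot),\mu\rangle)$ with values in $\mathscr L^\infty_{\mathbb Z,Y}$, for $F\in\mathscr L^\infty_{\mathbb Z^2,Y}$; and $(F,\mu_\bullet)\mapsto(j\mapsto\langle F(\cdot,j),\mu_j\rangle)$ from $\mathscr L^\infty_{\mathbb Z^2,Y}\times\mathscr L^\infty_{\mathbb Z,\mathfrak M}$ to $\mathscr L^\infty_{\mathbb Z,Y}$. Abstract PET structures. Let $\mathcal L$ be the Henson language with one sort name, constant symbol and function symbol for each item above. An (abstract) PET structure over $\mathbb Z$ is a model $\mathscr M$ of the $\mathcal L$-theory of the class of all classical PET structures over $\mathbb Z$. A superscript $\mathscr M$ denotes the interpretation of a symbol in $\mathscr M$. $\mathbb R^{\mathscr M}$ is identified with $\mathbb R$; $\mathbb N$ and $\mathbb Z$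 are identified, via the constants, with subsets of $\mathbb N^{\mathscr M}$ and $\mathbb Z^{\mathscr M}$; $\mathcal H^{\mathscr M}$ is a real Hilbert space; elements $T$ of $(\mathscr L^\infty_{\mathbb Z,\mathfrak B})^{\mathscr M}$ are identified, via evaluation, with functions $i\mapsto T_i$ from $\mathbb Z^{\mathscr M}$ to $\mathfrak B^{\mathscr M}$, and elements of $\mathfrak B^{\mathscr M}$ with bounded operators on $\mathcal H^{\mathscr M}$. Leibman sequences in $\mathscr M$. For $T\in(\mathscr L^\infty_{\mathbb Z,\mathfrak B})^{\mathscr M}$ and $i\in\mathbb Z^{\mathscr M}$, let $\Delta^iT\in(\mathscr L^\infty_{\mathbb Z,\mathfrak B})^{\mathscr M}$ be given by $(\Delta^iT)_j=T_{i+j}\circ T_j^*$ for $j\in\mathbb Z^{\mathscr M}$. For $d\in\mathbb N$ (standard), $T$ is a unitary Leibman sequence of degree at most $d$ if $T_i^*\circ T_i=I=T_i\circ T_i^*$ for all $i\in\mathbb Z^{\mathscr M}$ and $\Delta^{i_d}\cdots\Delta^{i_1}\Delta^{i_0}T$ is the constant function $I$ for all $i_0,\dots,i_d\in\mathbb Z^{\mathscr M}$. A unitary Leibman sequence is one of degree at most $d$ for some $d\in\mathbb N$. Averages. For $n\in\mathbb N^{\mathscr M}$, $\mathrm{AV}_nT=\langle T,\sigma_n\rangle\in\mathfrak B^{\mathscr M}$, and $\mathrm{AV}_nT(x)=(\mathrm{AV}_nT)(x)$. For standard $n\in\mathbb N$, $\mathrm{AV}_nT(x)=\frac1{n+1}\sum_{0\le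 i\le n}T_i(x)$. *)

(* Defs.v *)
From HB Require Import structures.
From mathcomp Require Import all_boot all_order all_algebra finmap.
From mathcomp Require Import all_classical all_reals all_analysis.
Import Order.TTheory GRing.Theory Num.Theory.
Import numFieldNormedType.Exports.

Set Implicit Arguments.
Unset Strict Implicit.
Unset Printing Implicit Defensive.

Local Open Scope classical_set_scope.
Local Open Scope ring_scope.

Section bounded_functions.
Context {R : realType} (X : pointedType) (V : normedModType R).

Definition bdd_pred : {pred X -> V} := fun f => `[< bounded_fun f >].

Record linf := Linf { linf_fun :> X -> V ; linfP : linf_fun \in bdd_pred }.

HB.instance Definition _ := [isSub for linf_fun].
HB.instance Definition _ := [Choice of linf by <:].

Lemma bounded_ex (f : X -> V) :
  bounded_fun f <-> exists M, forall x, `|f x| <= M.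
Proof.
have PF : ProperFilter (globally [set: X]).
  exact: (globally_properfilter (a := point)).
split=> [/ex_bound[M fM]|[M fM]].
  by exists M => x; exact: fM.
by apply/ex_bound; exists M => x _; exact: fM.
Qed.

Lemma bdd_predP (f : X -> V) :
  reflect (exists M, forall x, `|f x| <= M) (f \in bdd_pred).
Proof. by exact: equivP (asboolP _) (bounded_ex f). Qed.

Definition linf_of (f : X -> V) (h : exists M, forall x, `|f x| <= M) : linf :=
  Linf (introT (bdd_predP f) h).

Lemma linf_bound (f : linf) : exists M, forall x, `|f x| <= M.
Proof. exact/bdd_predP/(linfP f). Qed.

Lemma bdd_submod_closed : submod_closed bdd_pred.
Proof.
split; first by apply/bdd_predP; exists 0 => x; rewrite /= normr0.
move=> a f g /bdd_predP[M fM] /bdd_predP[N gN]; apply/bdd_predP.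
exists (`|a| * M + N) => x /=; rewrite (le_trans (ler_normD _ _))//.
by rewrite lerD// normrZ ler_wpM2l.
Qed.

HB.instance Definition _ :=
  GRing.isSubmodClosed.Build R (X -> V) bdd_pred bdd_submod_closed.
HB.instance Definition _ := [SubChoice_isSubLmodule of linf by <:].

Definition linf_norm (f : linf) : R := sup (range (fun x => `|f x|)).

Lemma linf_norm_ub (f : linf) x : `|f x| <= linf_norm f.
Proof.
apply: ub_le_sup; last by exists x.
by have [M fM] := linf_bound f; exists M => _ [y _ <-].
Qed.

Lemma linf_norm_le (f : linf) (K : R) :
  (forall x, `|f x| <= K) -> linf_norm f <= K.
Proof.
move=> fK; apply: ge_sup; first by exists `|f point|, point.
by move=> _ [y _ <-].
Qed.

Lemma linf_normD (f g : linf) : linf_norm (f + g) <= linf_norm f + linf_norm g.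
Proof.
apply: linf_norm_le => x /=; rewrite (le_trans (ler_normD _ _))//.
by rewrite lerD// linf_norm_ub.
Qed.

Lemma linf_normZ (a : R) (f : linf) : linf_norm (a *: f) = `|a| * linf_norm f.
Proof.
have le b (h : linf) : linf_norm (b *: h) <= `|b| * linf_norm h.
  by apply: linf_norm_le => x /=; rewrite normrZ ler_wpM2l// linf_norm_ub.
apply/eqP; rewrite eq_le le /=.
have [->|a0] := eqVneq a 0.
  by rewrite normr0 mul0r (le_trans _ (linf_norm_ub _ point)).
by rewrite -ler_pdivlMl ?normr_gt0// -normfV -{1}(scalerK a0 f).
Qed.

Lemma linf_norm0_eq0 (f : linf) : linf_norm f = 0 -> f = 0.
Proof.
move=> f0; apply/val_inj/funext => x /=; apply/eqP.
by rewrite -normr_le0 -f0 linf_norm_ub.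
Qed.

HB.instance Definition _ := Lmodule_isNormed.Build R linf
  linf_normD linf_normZ linf_norm0_eq0.

Lemma linf_ub (f : linf) x : `|f x| <= `|f|. Proof. exact: linf_norm_ub. Qed.

End bounded_functions.

Section bounded_operators.
Context {R : realType} (V : normedModType R).

Definition bop_pred : {pred V -> V} :=
  fun T => `[< linear T /\ exists M, forall x, `|T x| <= M * `|x| >].

Record bop := Bop { bop_fun :> V -> V ; bopP : bop_fun \in bop_pred }.

HB.instance Definition _ := [isSub for bop_fun].
HB.instance Definition _ := [Choice of bop by <:].

Lemma bop_predP (T : V -> V) :
  reflect (linear T /\ exists M, forall x, `|T x| <= M * `|x|)
          (T \in bop_pred).
Proof. exact: asboolP. Qed.

Definition bop_of (T : V -> V) (h1 : linear T)
  (h2 : exists M, forall x, `|T x| <= M * `|x|) : bop :=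
  Bop (introT (bop_predP T) (conj h1 h2)).

Lemma bop_linear (T : bop) : linear T.
Proof. by have /bop_predP[] := bopP T. Qed.

Lemma bop_bound (T : bop) : exists M, forall x, `|T x| <= M * `|x|.
Proof. by have /bop_predP[] := bopP T. Qed.

Lemma bop_submod_closed : submod_closed bop_pred.
Proof.
split.
  apply/bop_predP; split; first by move=> a x y /=; rewrite addr0 scaler0.
  by exists 0 => x; rewrite /= normr0 mul0r.
move=> a S T /bop_predP[lS [M SM]] /bop_predP[lT [N TN]]; apply/bop_predP.
have E z : (a *: S + T) z = a *: S z + T z by [].
split=> [b x y|].
  rewrite !E lS lT !scalerDr !scalerA mulrC -!addrA; congr (_ + _).
  by rewrite addrCA.
exists (`|a| * M + N) => x /=; rewrite (le_trans (ler_normD _ _))//.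
by rewrite mulrDl lerD// normrZ -mulrA ler_wpM2l.
Qed.

HB.instance Definition _ :=
  GRing.isSubmodClosed.Build R (V -> V) bop_pred bop_submod_closed.
HB.instance Definition _ := [SubChoice_isSubLmodule of bop by <:].

Definition bop_norm (T : bop) : R :=
  sup [set `|T x| | x in [set x : V | `|x| <= 1]].

Lemma bop0 (T : bop) : T 0 = 0.
Proof.
by have := bop_linear T (-1) 0 0; rewrite scaler0 addr0 scaleN1r addNr.
Qed.

Lemma bopZ (T : bop) a x : T (a *: x) = a *: T x.
Proof. by have := bop_linear T a x 0; rewrite bop0 !addr0. Qed.

Lemma bopD (T : bop) x y : T (x + y) = T x + T y.
Proof. by have := bop_linear T 1 x y; rewrite !scale1r. Qed.

Lemma bop_norm_le (T : bop) (K : R) : 0 <= K ->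
  (forall x, `|T x| <= K * `|x|) -> bop_norm T <= K.
Proof.
move=> K0 TK; apply: ge_sup.
  by exists `|T 0|, 0 => //=; rewrite normr0.
by move=> _ [x x1 <-]; rewrite (le_trans (TK x))// ler_piMr.
Qed.

Lemma bop_norm_ub (T : bop) x : `|T x| <= bop_norm T * `|x|.
Proof.
have [->|x0] := eqVneq x 0; first by rewrite bop0 !normr0 mulr0.
rewrite -ler_pdivrMr ?normr_gt0// mulrC -[(`|x|^-1)]ger0_norm ?invr_ge0//.
rewrite -normrZ -bopZ; apply: ub_le_sup.
  have [M TM] := bop_bound T; exists `|M| => _ [y y1 <-].
  rewrite (le_trans (TM y))// (le_trans (ler_wpM2r _ (ler_norm M)))//.
  by rewrite ler_piMr.
exists (`|x|^-1 *: x) => //=.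
by rewrite normrZ normfV normr_id mulVf ?normr_eq0.
Qed.

Lemma bop_norm_ge0 (T : bop) : 0 <= bop_norm T.
Proof.
apply: le_trans (normr_ge0 (T 0)) _; apply: ub_le_sup.
  have [M TM] := bop_bound T; exists `|M| => _ [y y1 <-].
  rewrite (le_trans (TM y))// (le_trans (ler_wpM2r _ (ler_norm M)))//.
  by rewrite ler_piMr.
by exists 0 => //=; rewrite normr0.
Qed.

Lemma bop_normD (S T : bop) : bop_norm (S + T) <= bop_norm S + bop_norm T.
Proof.
apply: bop_norm_le => [|x /=]; first by rewrite addr_ge0 ?bop_norm_ge0.
by rewrite (le_trans (ler_normD _ _))// mulrDl lerD// bop_norm_ub.
Qed.

Lemma bop_normZ (a : R) (T : bop) : bop_norm (a *: T) = `|a| * bop_norm T.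
Proof.
have le b (S : bop) : bop_norm (b *: S) <= `|b| * bop_norm S.
  apply: bop_norm_le => [|x /=]; first by rewrite mulr_ge0 ?bop_norm_ge0.
  by rewrite normrZ -mulrA ler_wpM2l// bop_norm_ub.
apply/eqP; rewrite eq_le le /=.
have [->|a0] := eqVneq a 0; first by rewrite normr0 mul0r bop_norm_ge0.
by rewrite -ler_pdivlMl ?normr_gt0// -normfV -{1}(scalerK a0 T).
Qed.

Lemma bop_norm0_eq0 (T : bop) : bop_norm T = 0 -> T = 0.
Proof.
move=> T0; apply/val_inj/funext => x /=; apply/eqP.
by rewrite -normr_le0 (le_trans (bop_norm_ub T x))// T0 mul0r.
Qed.

HB.instance Definition _ := Lmodule_isNormed.Build R bop
  bop_normD bop_normZ bop_norm0_eq0.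

Lemma bop_ub (T : bop) x : `|T x| <= `|T| * `|x|.
Proof. exact: bop_norm_ub. Qed.

Lemma bop_id_linear : linear (fun x : V => x). Proof. by []. Qed.

Lemma bop_id_bound : exists M : R, forall x : V, `|x| <= M * `|x|.
Proof. by exists 1 => x; rewrite mul1r. Qed.

Definition bop_id : bop := bop_of bop_id_linear bop_id_bound.

Lemma bop_comp_linear (S T : bop) : linear (fun x => S (T x)).
Proof. by move=> a x y; rewrite !bopD !bopZ. Qed.

Lemma bop_comp_bound (S T : bop) x : `|S (T x)| <= `|S| * `|T| * `|x|.
Proof.
by rewrite (le_trans (bop_ub _ _))// -mulrA ler_wpM2l// bop_ub.
Qed.

Definition bop_comp (S T : bop) : bop :=
  bop_of (bop_comp_linear S T) (ex_intro _ _ (bop_comp_bound S T)).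

Lemma bop_comp_norm (S T : bop) : `|bop_comp S T| <= `|S| * `|T|.
Proof. by apply: bop_norm_le; [rewrite mulr_ge0|exact: bop_comp_bound]. Qed.

End bounded_operators.

(* Finite signed measures on Z, identified with their families of coefficients
   (c i = mu {i}); the norm is the total mass. *)
Section measures.
Context {R : realType}.

Definition meas_pred : {pred int -> R^o} :=
  fun c => `[< summable [set: int] (fun i => (c i)%:E) >].

Record meas := Meas { meas_fun :> int -> R^o ; measP : meas_fun \in meas_pred }.

HB.instance Definition _ := [isSub for meas_fun].
HB.instance Definition _ := [Choice of meas by <:].

Lemma meas_predP (c : int -> R^o) :
  reflect (exists K : R, forall s, uniq s -> \sum_(i <- s) `|c i| <= K)
          (c \in meas_pred).
Proof.
apply: (iffP (asboolP _)) => [|[K cK]].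
  rewrite summableE => /fineK sc.
  exists (fine (\esum_(i in [set: int]) `|(c i)%:E|)%E) => s us.
  rewrite -lee_fin sc; apply: esum_ge; exists [set` s]; first by split=> //; exact: finite_seq.
  rewrite -fsbig_seq//= -sumEFin.
  exact: lee_sum.
rewrite /summable; apply: le_lt_trans (ltry K).
apply: ge_ereal_sup => _ [A [finA _] <-].
rewrite fsbig_finite//= (eq_bigr (fun i => `|c i|%:E)); last first.
  by [].
by rewrite sumEFin lee_fin cK// fset_uniq.
Qed.

Definition meas_of (c : int -> R^o)
  (h : exists K : R, forall s, uniq s -> \sum_(i <- s) `|c i| <= K) : meas :=
  Meas (introT (meas_predP c) h).

Definition meas_norm (c : meas) : R :=
  fine (\esum_(i in [set: int]) `|(c i)%:E|)%E.

Lemma meas_norm_ub (c : meas) s : uniq s -> \sum_(i <- s) `|c i| <= meas_norm c.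
Proof.
move=> us; have /asboolP := measP c; rewrite summableE => /fineK sc.
rewrite -lee_fin sc; apply: esum_ge; exists [set` s]; first by split=> //; exact: finite_seq.
rewrite -fsbig_seq//= -sumEFin.
exact: lee_sum.
Qed.

Lemma meas_norm_le (c : meas) K :
  (forall s, uniq s -> \sum_(i <- s) `|c i| <= K) -> meas_norm c <= K.
Proof.
move=> cK; have /asboolP := measP c; rewrite summableE => /fineK sc.
rewrite -lee_fin sc; apply: ge_ereal_sup => _ [A [finA _] <-].
rewrite fsbig_finite//= (eq_bigr (fun i => `|c i|%:E)); last first.
  by [].
by rewrite sumEFin lee_fin cK// fset_uniq.
Qed.

Lemma meas_norm_ge0 (c : meas) : 0 <= meas_norm c.
Proof. by rewrite (le_trans _ (@meas_norm_ub c [::] _))// big_nil. Qed.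

Lemma meas_submod_closed : submod_closed meas_pred.
Proof.
split.
  by apply/meas_predP; exists 0 => s _; rewrite big1// => i _; rewrite normr0.
move=> a b c /meas_predP[K bK] /meas_predP[L cL]; apply/meas_predP.
exists (`|a| * K + L) => s us.
apply: (@le_trans _ _ (\sum_(i <- s) (`|a| * `|b i| + `|c i|))).
  by apply: ler_sum => i _; rewrite (le_trans (ler_normD _ _))// normrZ.
by rewrite big_split/= -mulr_sumr lerD ?cL// ler_wpM2l ?bK.
Qed.

HB.instance Definition _ :=
  GRing.isSubmodClosed.Build R (int -> R^o) meas_pred meas_submod_closed.
HB.instance Definition _ := [SubChoice_isSubLmodule of meas by <:].

Lemma meas_normD (b c : meas) : meas_norm (b + c) <= meas_norm b + meas_norm c.
Proof.
apply: meas_norm_le => s us.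
apply: (@le_trans _ _ (\sum_(i <- s) (`|b i| + `|c i|))).
  by apply: ler_sum => i _; exact: ler_normD.
by rewrite big_split/= lerD// meas_norm_ub.
Qed.

Lemma meas_normZ (a : R) (c : meas) : meas_norm (a *: c) = `|a| * meas_norm c.
Proof.
have le b (d : meas) : meas_norm (b *: d) <= `|b| * meas_norm d.
  apply: meas_norm_le => s us; under eq_bigr do rewrite /= normrZ.
  by rewrite -mulr_sumr ler_wpM2l// meas_norm_ub.
apply/eqP; rewrite eq_le le /=.
have [->|a0] := eqVneq a 0; first by rewrite normr0 mul0r meas_norm_ge0.
by rewrite -ler_pdivlMl ?normr_gt0// -normfV -{1}(scalerK a0 c).
Qed.

Lemma meas_norm0_eq0 (c : meas) : meas_norm c = 0 -> c = 0.
Proof.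
move=> c0; apply/val_inj/funext => i /=; apply/eqP.
rewrite -normr_le0 -c0; have := @meas_norm_ub c [:: i].
by rewrite big_seq1; apply.
Qed.

HB.instance Definition _ := Lmodule_isNormed.Build R meas
  meas_normD meas_normZ meas_norm0_eq0.

End measures.
Arguments meas R : clear implicits.

HB.instance Definition _ := isPointed.Build int 0.

Section measure_operations.
Context {R : realType}.
Implicit Types (b c : meas R).

Lemma dirac_subproof (i : int) : exists K : R,
  forall s : seq int, uniq s -> \sum_(k <- s) `|(k == i)%:R : R^o| <= K.
Proof.
exists 1 => s us; rewrite (eq_bigr (fun k => (k == i)%:R)); last first.
  by move=> k _; rewrite normr_nat.
have -> : \sum_(k <- s) (k == i)%:R = (count_mem i s)%:R :> R.
  by rewrite -sum1_count natr_sum [RHS]big_mkcond; apply: eq_bigr => k _ /=; case: eqP.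
by rewrite count_uniq_mem// lern1 leq_b1.
Qed.
Definition dirac_meas (i : int) : meas R := meas_of (dirac_subproof i).

Definition sigma_meas (n : nat) : meas R :=
  n.+1%:R^-1 *: \sum_(i < n.+1) dirac_meas i%:Z.

Lemma tv_subproof c : exists K : R,
  forall s, uniq s -> \sum_(i <- s) `| `|c i| : R^o | <= K.
Proof.
exists `|c| => s us; under eq_bigr do rewrite normr_id.
exact: meas_norm_ub.
Qed.
Definition tv_meas c : meas R := meas_of (tv_subproof c).

Lemma max_subproof b c : exists K : R,
  forall s, uniq s -> \sum_(i <- s) `|Num.max (b i) (c i) : R^o| <= K.
Proof.
exists (`|b| + `|c|) => s us.
apply: (@le_trans _ _ (\sum_(i <- s) (`|b i| + `|c i|))).
  apply: ler_sum => i _; have [_|_] := leP (b i) (c i); first by rewrite lerDr.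
  by rewrite lerDl.
by rewrite big_split lerD// meas_norm_ub.
Qed.
Definition max_meas b c : meas R := meas_of (max_subproof b c).

Lemma min_subproof b c : exists K : R,
  forall s, uniq s -> \sum_(i <- s) `|Num.min (b i) (c i) : R^o| <= K.
Proof.
exists (`|b| + `|c|) => s us.
apply: (@le_trans _ _ (\sum_(i <- s) (`|b i| + `|c i|))).
  apply: ler_sum => i _; have [_|_] := leP (b i) (c i); first by rewrite lerDl.
  by rewrite lerDr.
by rewrite big_split lerD// meas_norm_ub.
Qed.
Definition min_meas b c : meas R := meas_of (min_subproof b c).

Lemma trans_meas_ub c (i : int) s : uniq s ->
  \sum_(k <- s) `|c (k + i)| <= `|c|.
Proof.
move=> us; rewrite -(big_map (+%R^~ i) xpredT (fun k => `|c k|)).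
by apply: meas_norm_ub; rewrite map_inj_uniq//; exact: addIr.
Qed.
(* If c = \sum_j c_j delta_j then trans_meas c i = \sum_j c_j delta_{j - i},
   whose mass at k is c_{k + i}. *)
Definition trans_meas c (i : int) : meas R :=
  meas_of (ex_intro _ _ (@trans_meas_ub c i)).

Lemma mtrans_subproof c : exists M, forall i, `|trans_meas c i| <= M.
Proof. by exists `|c| => i; apply: meas_norm_le => s; exact: trans_meas_ub. Qed.
Definition mtrans c : linf int (meas R) := linf_of (mtrans_subproof c).

End measure_operations.

Section integration.
Context {R : realType} {V : normedModType R}.

(* \sum_i c_i f(i); the sum is absolutely convergent in all the uses below,
   where f is bounded and V is complete *)
Definition integ (f : int -> V) (c : meas R) : V :=
  limn (fun n => \sum_(k < n.*2.+1) c (k%:Z - n%:Z) *: f (k%:Z - n%:Z)).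

(* lim is `point` when the limit does not exist, hence the first summand *)
Lemma integ_le (f : int -> V) (c : meas R) (K : R) :
  (forall i, `|f i| <= K) -> `|integ f c| <= `|point : V| + `|c| * K.
Proof.
move=> fK; have K0 : 0 <= K by rewrite (le_trans _ (fK 0)).
rewrite /integ; set u := (fun n => _ : V).
have [cu|/dvgP] := pselect (cvgn u); last first.
  by move=> ->; rewrite lerDl mulr_ge0.
apply: (@le_trans _ _ (`|c| * K)); last by rewrite lerDr.
rewrite -lim_norm//; apply: limr_le; first exact: is_cvg_norm.
near=> n; rewrite /u (le_trans (ler_norm_sum _ _ _))//.
apply: (@le_trans _ _ (\sum_(k < n.*2.+1) `|c (k%:Z - n%:Z)| * K)).
  by apply: ler_sum => k _; rewrite normrZ ler_wpM2l.
rewrite -mulr_suml ler_wpM2r//.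
rewrite -(big_mkord xpredT (fun k => `|c (k%:Z - n%:Z)|)).
rewrite -(big_map (fun k : nat => k%:Z - n%:Z) xpredT (fun k => `|c k|)).
apply: meas_norm_ub; rewrite map_inj_uniq ?iota_uniq// => i j /addIr[].
by [].
Unshelve. all: by end_near. Qed.

Lemma integL_subproof (c : meas R) (F : linf (int * int)%type V) :
  exists M, forall j, `|integ (fun i => F (i, j)) c| <= M.
Proof. by eexists => j; apply: integ_le => i; exact: linf_ub. Qed.
Definition integL c F : linf int V := linf_of (integL_subproof c F).

Lemma integR_subproof (F : linf (int * int)%type V) (c : meas R) :
  exists M, forall i, `|integ (fun j => F (i, j)) c| <= M.
Proof. by eexists => j; apply: integ_le => i; exact: linf_ub. Qed.
Definition integR F c : linf int V := linf_of (integR_subproof F c).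

Lemma integD_subproof (F : linf (int * int)%type V) (nu : linf int (meas R)) :
  exists M, forall j, `|integ (fun i => F (i, j)) (nu j)| <= M.
Proof.
exists (`|point : V| + `|nu| * `|F|) => j.
apply: (le_trans (integ_le _ (fun i => linf_ub F (i, j)))).
by rewrite lerD2l ler_wpM2r// linf_ub.
Qed.
Definition integD F nu : linf int V := linf_of (integD_subproof F nu).

End integration.

Section linf_operations.
Context {R : realType}.

Lemma linf_precomp_subproof (X X' : pointedType) (V : normedModType R)
    (g : X' -> X) (f : linf X V) :
  exists M, forall x, `|f (g x)| <= M.
Proof. by exists `|f| => x; exact: linf_ub. Qed.
Definition linf_precomp (X X' : pointedType) (V : normedModType R)
    (g : X' -> X) (f : linf X V) : linf X' V :=
  linf_of (linf_precomp_subproof g f).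

Lemma linf_cst_subproof (X : pointedType) (V : normedModType R) (v : V) :
  exists M, forall x : X, `|(fun=> v) x| <= M.
Proof. by exists `|v|. Qed.
Definition linf_cst (X : pointedType) (V : normedModType R) (v : V) :
  linf X V := linf_of (linf_cst_subproof X v).

Section pointwise.
Context {X : pointedType} {V : normedModType R}.

Lemma linf_pnorm_subproof (f : linf X V) :
  exists M, forall x, `| `|f x| : R^o | <= M.
Proof. by exists `|f| => x; rewrite normr_id linf_ub. Qed.
Definition linf_pnorm (f : linf X V) : linf X R^o :=
  linf_of (linf_pnorm_subproof f).

Lemma linf_max_subproof (f g : linf X R^o) :
  exists M, forall x, `|Num.max (f x) (g x) : R^o| <= M.
Proof.
exists (`|f| + `|g|) => x; have [_|_] := leP (f x) (g x).
  by rewrite (le_trans (linf_ub g x))// lerDr.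
by rewrite (le_trans (linf_ub f x))// lerDl.
Qed.
Definition linf_max (f g : linf X R^o) : linf X R^o :=
  linf_of (linf_max_subproof f g).

Lemma linf_min_subproof (f g : linf X R^o) :
  exists M, forall x, `|Num.min (f x) (g x) : R^o| <= M.
Proof.
exists (`|f| + `|g|) => x; have [_|_] := leP (f x) (g x).
  by rewrite (le_trans (linf_ub f x))// lerDl.
by rewrite (le_trans (linf_ub g x))// lerDr.
Qed.
Definition linf_min (f g : linf X R^o) : linf X R^o :=
  linf_of (linf_min_subproof f g).

Lemma linf_comp_subproof (S T : linf X (bop V)) :
  exists M, forall x, `|bop_comp (S x) (T x)| <= M.
Proof.
exists (`|S| * `|T|) => x; rewrite (le_trans (bop_comp_norm _ _))//.
by rewrite ler_pM// linf_ub.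
Qed.
Definition linf_comp (S T : linf X (bop V)) : linf X (bop V) :=
  linf_of (linf_comp_subproof S T).

Lemma linf_app_subproof (T : linf X (bop V)) (f : linf X V) :
  exists M, forall x, `|T x (f x)| <= M.
Proof.
exists (`|T| * `|f|) => x; rewrite (le_trans (bop_ub _ _))//.
by rewrite ler_pM// linf_ub.
Qed.
Definition linf_app (T : linf X (bop V)) (f : linf X V) : linf X V :=
  linf_of (linf_app_subproof T f).

End pointwise.

Lemma linf_indic_subproof (A : set int) :
  exists M : R, forall i, `|\1_A i : R^o| <= M.
Proof. by exists 1 => i; rewrite indicE normr_nat lern1 leq_b1. Qed.
Definition linf_indic (A : set int) : linf int (R^o : normedModType R) :=
  linf_of (linf_indic_subproof A).

End linf_operations.

(* Real Hilbert spaces: the norm of a complete normed space is induced by an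
   inner product (a positive definite symmetric bilinear form). *)
Record hilbert (R : realType) := Hilbert {
  hilbert_space :> completeNormedModType R ;
  inner : {dot hilbert_space for idfun} ;
  inner_norm : forall x, inner x x = `|x| ^+ 2 }.

Section hilbert_operations.
Context {R : realType} (H : hilbert R).
Implicit Types (x y : H) (T : bop H).

Lemma innerC x y : inner H x y = inner H y x.
Proof. by have := hermC (inner H) x y; rewrite expr0 mul1r. Qed.

Lemma cauchy_schwarz x y : `|inner H x y| <= `|x| * `|y|.
Proof.
have [->|y0] := eqVneq y 0; first by rewrite linear0r !normr0 mulr0.
have ny : 0 < `|y| by rewrite normr_gt0.
have [t tE] : exists t, t * `|y| ^+ 2 = inner H x y.
  by exists (inner H x y / `|y| ^+ 2); rewrite divfK// expf_neq0 ?gt_eqF.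
have : 0 <= `|x - t *: y| ^+ 2 by rewrite sqr_ge0.
rewrite -inner_norm linearBl !linearBr !linearZl_LR !linearZr_LR/=.
rewrite (innerC y x) !inner_norm tE subrr subr0 subr_ge0 => h.
rewrite -(@ler_pXn2r _ 2) ?nnegrE ?mulr_ge0// real_normK ?num_real// exprMn.
rewrite [leLHS](_ : _ = t * inner H x y * `|y| ^+ 2) ?ler_wpM2r ?sqr_ge0//.
by rewrite mulrAC tE expr2.
Qed.

Lemma linf_inner_subproof (X : pointedType) (f g : linf X H) :
  exists M, forall i, `|inner H (f i) (g i) : R^o| <= M.
Proof.
exists (`|f| * `|g|) => x; rewrite (le_trans (cauchy_schwarz _ _))//.
by rewrite ler_pM// linf_ub.
Qed.
Definition linf_inner (X : pointedType) (f g : linf X H) : linf X R^o :=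
  linf_of (linf_inner_subproof f g).

(* The adjoint, which exists by the Riesz representation theorem *)
Definition adj T : bop H :=
  xget 0 [set S : bop H | forall x y, inner H (T x) y = inner H x (S y)].

Lemma adj_norm T : `|adj T| <= `|T|.
Proof.
rewrite /adj; case: xgetP => [S _ /= TS|_]; last by rewrite normr0.
apply: bop_norm_le => // y.
have [->|Sy0] := eqVneq (S y) 0; first by rewrite normr0 mulr_ge0.
rewrite -(@ler_pM2l _ `|S y|) ?normr_gt0//.
rewrite -expr2 -inner_norm -TS (le_trans (ler_norm _))//.
rewrite (le_trans (cauchy_schwarz _ _))// mulrA ler_wpM2r//.
by rewrite mulrC bop_ub.
Qed.

Lemma linf_adj_subproof (X : pointedType) (T : linf X (bop H)) :
  exists M, forall i, `|adj (T i)| <= M.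
Proof.
by exists `|T| => x; rewrite (le_trans (adj_norm _))// linf_ub.
Qed.
Definition linf_adj (X : pointedType) (T : linf X (bop H)) : linf X (bop H) :=
  linf_of (linf_adj_subproof T).

End hilbert_operations.

Definition discrete (R : realType) (T : choiceType) : Type := T.

Section discrete.
Context {R : realType} (T : choiceType).

HB.instance Definition _ := Choice.on (discrete R T).

Let dist (x y : discrete R T) : R := (x != y)%:R.

Let distxx x : dist x x = 0. Proof. by rewrite /dist eqxx. Qed.

Let dist0 x y : dist x y = 0 -> x = y.
Proof. by rewrite /dist; case: eqP => // _ /eqP; rewrite oner_eq0. Qed.

Let dist_sym x y : dist x y = dist y x.
Proof. by rewrite /dist eq_sym. Qed.

Let dist_triangle y x z : dist x z <= dist x y + dist y z.
Proof.
rewrite /dist -natrD ler_nat; case: (eqVneq x y) => [->//|_].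
by case: (x != z).
Qed.

HB.instance Definition _ := isMetric.Build R (discrete R T)
  distxx dist0 dist_sym dist_triangle.

End discrete.

Definition normed_metric (R : realType) (V : normedModType R) : Type := V.

Section normed_metric.
Context {R : realType} (V : normedModType R).

HB.instance Definition _ := PseudoMetric.copy (normed_metric V) V.

Let dist (x y : normed_metric V) : R := `|(y : V) - x|.

Let dist_ge0 x y : 0 <= dist x y. Proof. exact: normr_ge0. Qed.

Let dist0 x y : dist x y = 0 -> x = y.
Proof. by move=> /normr0_eq0/eqP; rewrite subr_eq0 => /eqP. Qed.

Let ballE x d : ball x d = [set y | dist x y < d].
Proof.
by rewrite -[ball x d]/(@ball R V x d) -ball_normE; apply/seteqP; split => y /=;
  rewrite /dist distrC.
Qed.

HB.instance Definition _ := PseudoMetric_isMetric.Build R (normed_metric V)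
  dist_ge0 dist0 ballE.

End normed_metric.

Inductive hsort (S : Type) := Real | Srt of S.
Arguments Real {S}.

(* Many-sorted languages with a designated sort for the reals. The metrics of
   all sorts and the anchor points are part of every structure; the metric
   symbols are the term constructor [TDist] below. *)
Record language := Language {
  lsort : Type ;
  lconst : Type ;
  lfunc : Type ;
  const_sort : lconst -> hsort lsort ;
  func_dom : lfunc -> seq (hsort lsort) ;
  func_cod : lfunc -> hsort lsort }.

Fixpoint htuple (S : Type) (C : S -> Type) (l : seq S) : Type :=
  if l is s :: l' then (C s * htuple C l')%type else unit.

Section syntax.
Context (L : language).
Local Notation hsort := (hsort (lsort L)).

(* de Bruijn variables in a context, the context listing the sorts of the
   variables in scope *)
Inductive var : seq hsort -> hsort -> Type :=
| Var0 G s : var (s :: G) s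
| VarS G s t : var G s -> var (t :: G) s.

Inductive term (G : seq hsort) : hsort -> Type :=
| TVar s : var G s -> term G s
| TCst c : term G (const_sort c)
| TApp f : terms G (func_dom f) -> term G (func_cod f)
| TDist s : term G s -> term G s -> term G Real
with terms (G : seq hsort) : seq hsort -> Type :=
| TNil : terms G [::]
| TCons s l : term G s -> terms G l -> terms G (s :: l).

Inductive formula : seq hsort -> Type :=
| FLe G : term G Real -> rat -> formula G
| FGe G : term G Real -> rat -> formula G
| FAnd G : formula G -> formula G -> formula G
| FOr G : formula G -> formula G -> formula G
| FEx G s : rat -> formula (s :: G) -> formula G
| FAll G s : rat -> formula (s :: G) -> formula G.

Definition sentence := formula [::].

(* [fapprox p p'] : p' is an approximation of p *)
Inductive fapprox : forall G, formula G -> formula G -> Prop :=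
| approx_Le G (t : term G Real) r r' : r < r' -> fapprox (FLe t r) (FLe t r')
| approx_Ge G (t : term G Real) r r' : r' < r -> fapprox (FGe t r) (FGe t r')
| approx_And G (p p' q q' : formula G) :
    fapprox p p' -> fapprox q q' -> fapprox (FAnd p q) (FAnd p' q')
| approx_Or G (p p' q q' : formula G) :
    fapprox p p' -> fapprox q q' -> fapprox (FOr p q) (FOr p' q')
| approx_Ex G s r r' (p p' : formula (s :: G)) :
    r < r' -> fapprox p p' -> fapprox (FEx r p) (FEx r' p')
| approx_All G s r r' (p p' : formula (s :: G)) :
    r' < r -> fapprox p p' -> fapprox (FAll r p) (FAll r' p').

End syntax.

Section semantics.
Context {R : realType} {L : language}.
Local Notation hsort := (hsort (lsort L)).

Definition carrier_of (C : lsort L -> metricType R) (s : hsort) : metricType R :=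
  if s is Srt s' then C s' else R^o.

Record structure := Structure {
  nonreal : lsort L -> metricType R ;
  nonreal_anchor : forall s, nonreal s ;
  const_interp : forall c : lconst L, carrier_of nonreal (const_sort c) ;
  func_interp : forall f : lfunc L,
    htuple (carrier_of nonreal) (func_dom f) ->
    carrier_of nonreal (func_cod f) }.

Definition carrier (M : structure) (s : hsort) : metricType R :=
  carrier_of (@nonreal M) s.

Definition anchor (M : structure) (s : hsort) : carrier M s :=
  match s return carrier M s with
  | Real => (0 : R^o)
  | Srt s' => nonreal_anchor M s'
  end.

Section satisfaction.
Context (M : structure).

Fixpoint lookup G s (v : var G s) : htuple (carrier M) G -> carrier M s :=
  match v in var G s return htuple (carrier M) G -> carrier M s with
  | Var0 G s => fun e => e.1
  | VarS G s t v => fun e => lookup v e.2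
  end.

Fixpoint eval G (e : htuple (carrier M) G) s (t : term G s) : carrier M s :=
  match t in term _ s return carrier M s with
  | TVar s v => lookup v e
  | TCst c => const_interp M c
  | TApp f l => func_interp (evals e l)
  | TDist s t u => mdist (eval e t) (eval e u)
  end
with evals G (e : htuple (carrier M) G) l (ts : terms G l) :
    htuple (carrier M) l :=
  match ts in terms _ l return htuple (carrier M) l with
  | TNil => tt
  | TCons s l t ts => (eval e t, evals e ts)
  end.

Fixpoint sat G (p : formula G) : htuple (carrier M) G -> Prop :=
  match p in formula G return htuple (carrier M) G -> Prop with
  | FLe G t r => fun e => (eval e t : R) <= ratr r
  | FGe G t r => fun e => ratr r <= (eval e t : R)
  | FAnd G p q => fun e => sat p e /\ sat q e
  | FOr G p q => fun e => sat p e \/ sat q e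
  | FEx G s r p => fun e =>
      exists x : carrier M s, mdist (anchor M s) x <= ratr r /\ sat p (x, e)
  | FAll G s r p => fun e =>
      forall x : carrier M s, mdist (anchor M s) x < ratr r -> sat p (x, e)
  end.

Definition approx_sat (p : sentence L) : Prop :=
  forall p', fapprox p p' -> sat p' tt.

Fixpoint hbounded (r : R) (l : seq hsort) : htuple (carrier M) l -> Prop :=
  match l return htuple (carrier M) l -> Prop with
  | [::] => fun=> True
  | s :: l' => fun u => mdist (anchor M s) u.1 <= r /\ hbounded r u.2
  end.

Fixpoint hnear (d : R) (l : seq hsort) :
    htuple (carrier M) l -> htuple (carrier M) l -> Prop :=
  match l return htuple (carrier M) l -> htuple (carrier M) l -> Prop with
  | [::] => fun _ _ => True
  | s :: l' => fun u v => mdist u.1 v.1 < d /\ hnear d u.2 v.2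
  end.

Definition henson_structure : Prop :=
  forall (f : lfunc L) (r : R),
    (exists K : R, forall u, hbounded r u ->
       mdist (anchor M (func_cod f)) (func_interp u) <= K) /\
    (forall e : R, 0 < e -> exists2 d : R, 0 < d &
       forall u v, hbounded r u -> hbounded r v -> hnear d u v ->
         mdist (func_interp (f := f) u) (func_interp v) < e).

End satisfaction.

Definition theory (K : structure -> Prop) (p : sentence L) : Prop :=
  forall M, K M -> approx_sat M p.

Definition model (M : structure) (Th : sentence L -> Prop) : Prop :=
  forall p, Th p -> approx_sat M p.

End semantics.
Arguments structure : clear implicits.

(* The domains X = Z, Z^2 and the values Y = R, H, B of the sorts L^oo_{X,Y};
   the sort L^oo_{Z,M}, which has no counterpart over Z^2, is [BLM]. *)
Inductive pet_dom := DZ | DZ2.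
Inductive pet_val := VR | VH | VB.

(* The Banach sorts other than the reals *)
Inductive banach_sort :=
| BH | BB | BM | BL of pet_dom & pet_val | BLM.

Inductive pet_sort := SN | SZ | SA | SBan of banach_sort.

Definition sR : hsort pet_sort := Real.
Definition sN : hsort pet_sort := Srt SN.
Definition sZ : hsort pet_sort := Srt SZ.
Definition sA : hsort pet_sort := Srt SA.
Definition sBan (b : banach_sort) : hsort pet_sort := Srt (SBan b).
Definition sH := sBan BH.
Definition sB := sBan BB.
Definition sM := sBan BM.
Definition sL (X : pet_dom) (Y : pet_val) := sBan (BL X Y).
Definition sLM := sBan BLM.
Definition sval (Y : pet_val) : hsort pet_sort :=
  match Y with VR => sR | VH => sH | VB => sB end.

Inductive pet_const :=
| CN of nat | CZ of int | CR of rat | CZero of banach_sort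
| CId | CEmpty | CFull.

Definition pet_const_sort (c : pet_const) : hsort pet_sort :=
  match c with
  | CN _ => sN
  | CZ _ => sZ
  | CR _ => sR
  | CZero b => sBan b
  | CId => sB
  | CEmpty | CFull => sA
  end.

Inductive pet_func :=
| RAdd | RSub | RMul | RAbs | RMin | RMax
| NLe
| ZMem
| ZAdd | ZOpp
| AUnion | AInter | ACompl
| BanAdd of banach_sort | BanScale of banach_sort | BanNorm of banach_sort
| HInner
| LInner of pet_dom
| LAbs of pet_dom | LMax of pet_dom | LMin of pet_dom
| MTV | MMax | MMin
| LNorm of pet_dom & pet_val | LMNorm
| BAdj | BComp
| LAdj of pet_dom | LComp of pet_dom
| ZSing | AChi | ZDirac
| LCst of pet_dom & pet_val | LMCst
| LSnd of pet_val                     (* f |-> ((w, x) |-> f x) *)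
| LFst of pet_val                     (* f |-> ((w, x) |-> f w) *)
| BEval
| LEval1 of pet_val | LEval2 of pet_val
| LMEval
| LApp of pet_dom
| LRow of pet_val                     (* (F, i) |-> F(i, .) *)
| LCol of pet_val                     (* (F, j) |-> F(., j) *)
| Sigma
| LTrans of pet_val | LShear of pet_val | LSwap of pet_val
| MTrans
| Int of pet_val | IntM               (* (f, mu) |-> <f, mu> *)
| IntL of pet_val                     (* (mu, F) |-> (j |-> <F(., j), mu>) *)
| IntR of pet_val                     (* (F, mu) |-> (i |-> <F(i, .), mu>) *)
| IntD of pet_val.                    (* (F, nu) |-> (j |-> <F(., j), nu_j>) *)

Definition pet_dom_cod (f : pet_func) : seq (hsort pet_sort) * hsort pet_sort :=
  match f with
  | RAdd | RSub | RMul | RMin | RMax => ([:: sR; sR], sR)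
  | RAbs => ([:: sR], sR)
  | NLe => ([:: sN; sN], sR)
  | ZMem => ([:: sZ; sA], sR)
  | ZAdd => ([:: sZ; sZ], sZ)
  | ZOpp => ([:: sZ], sZ)
  | AUnion | AInter => ([:: sA; sA], sA)
  | ACompl => ([:: sA], sA)
  | BanAdd b => ([:: sBan b; sBan b], sBan b)
  | BanScale b => ([:: sR; sBan b], sBan b)
  | BanNorm b => ([:: sBan b], sR)
  | HInner => ([:: sH; sH], sR)
  | LInner X => ([:: sL X VH; sL X VH], sL X VR)
  | LAbs X => ([:: sL X VR], sL X VR)
  | LMax X | LMin X => ([:: sL X VR; sL X VR], sL X VR)
  | MTV => ([:: sM], sM)
  | MMax | MMin => ([:: sM; sM], sM)
  | LNorm X Y => ([:: sL X Y], sL X VR)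
  | LMNorm => ([:: sLM], sL DZ VR)
  | BAdj => ([:: sB], sB)
  | BComp => ([:: sB; sB], sB)
  | LAdj X => ([:: sL X VB], sL X VB)
  | LComp X => ([:: sL X VB; sL X VB], sL X VB)
  | ZSing => ([:: sZ], sA)
  | AChi => ([:: sA], sL DZ VR)
  | ZDirac => ([:: sZ], sM)
  | LCst X Y => ([:: sval Y], sL X Y)
  | LMCst => ([:: sM], sLM)
  | LSnd Y | LFst Y => ([:: sL DZ Y], sL DZ2 Y)
  | BEval => ([:: sB; sH], sH)
  | LEval1 Y => ([:: sL DZ Y; sZ], sval Y)
  | LEval2 Y => ([:: sL DZ2 Y; sZ; sZ], sval Y)
  | LMEval => ([:: sLM; sZ], sM)
  | LApp X => ([:: sL X VB; sL X VH], sL X VH)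
  | LRow Y | LCol Y => ([:: sL DZ2 Y; sZ], sL DZ Y)
  | Sigma => ([:: sN], sM)
  | LTrans Y => ([:: sL DZ Y], sL DZ2 Y)
  | LShear Y | LSwap Y => ([:: sL DZ2 Y], sL DZ2 Y)
  | MTrans => ([:: sM], sLM)
  | Int Y => ([:: sL DZ Y; sM], sval Y)
  | IntM => ([:: sLM; sM], sM)
  | IntL Y => ([:: sM; sL DZ2 Y], sL DZ Y)
  | IntR Y => ([:: sL DZ2 Y; sM], sL DZ Y)
  | IntD Y => ([:: sL DZ2 Y; sLM], sL DZ Y)
  end.

Definition pet_lang : language := {|
  lsort := pet_sort ;
  lconst := pet_const ;
  lfunc := pet_func ;
  const_sort := pet_const_sort ;
  func_dom := fun f => (pet_dom_cod f).1 ;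
  func_cod := fun f => (pet_dom_cod f).2 |}.

Definition ap1 (A B : Type) (f : A -> B) (u : A * unit) : B := f u.1.
Definition ap2 (A1 A2 B : Type) (f : A1 -> A2 -> B)
  (u : A1 * (A2 * unit)) : B := f u.1 u.2.1.
Definition ap3 (A1 A2 A3 B : Type) (f : A1 -> A2 -> A3 -> B)
  (u : A1 * (A2 * (A3 * unit))) : B := f u.1 u.2.1 u.2.2.1.

Section classical.
Context {R : realType} (H : hilbert R).

Definition dom_type (X : pet_dom) : pointedType :=
  match X with DZ => int | DZ2 => (int * int)%type end.

Definition val_space (Y : pet_val) : normedModType R :=
  match Y with VR => R^o | VH => H | VB => bop H end.

Definition banach_space (b : banach_sort) : normedModType R :=
  match b with
  | BH => H
  | BB => bop H
  | BM => meas R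
  | BL X Y => linf (dom_type X) (val_space Y)
  | BLM => linf int (meas R)
  end.

Definition classical_nonreal (s : pet_sort) : metricType R :=
  match s with
  | SN => discrete R nat
  | SZ => discrete R int
  | SA => discrete R (set int)
  | SBan b => normed_metric (banach_space b)
  end.

Definition classical_anchor (s : pet_sort) : classical_nonreal s :=
  match s return classical_nonreal s with
  | SN => 0%N
  | SZ => 0 : int
  | SA => set0 : set int
  | SBan b => 0 : banach_space b
  end.

Local Notation C := (@carrier_of R pet_lang classical_nonreal).

Definition classical_const (c : pet_const) : C (pet_const_sort c) :=
  match c return C (pet_const_sort c) with
  | CN n => n
  | CZ i => i
  | CR q => ratr q : R
  | CZero b => 0 : banach_space b
  | CId => bop_id H
  | CEmpty => set0 : set int
  | CFull => setT : set int
  end.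

Definition of_val (Y : pet_val) : val_space Y -> C (sval Y) :=
  match Y return val_space Y -> C (sval Y) with
  | VR | VH | VB => id
  end.
Definition to_val (Y : pet_val) : C (sval Y) -> val_space Y :=
  match Y return C (sval Y) -> val_space Y with
  | VR | VH | VB => id
  end.

Local Notation L1 Y := (linf int (val_space Y)).
Local Notation L2 Y := (linf (int * int)%type (val_space Y)).

Definition classical_func (f : pet_func) :
    htuple C (pet_dom_cod f).1 -> C (pet_dom_cod f).2 :=
  match f return htuple C (pet_dom_cod f).1 -> C (pet_dom_cod f).2 with
  | RAdd => ap2 (fun x y : R => x + y)
  | RSub => ap2 (fun x y : R => x - y)
  | RMul => ap2 (fun x y : R => x * y)
  | RAbs => ap1 (fun x : R => `|x|)
  | RMin => ap2 (fun x y : R => Num.min x y)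
  | RMax => ap2 (fun x y : R => Num.max x y)
  | NLe => ap2 (fun m n : nat => (m <= n)%N%:R : R)
  | ZMem => ap2 (fun (i : int) (A : set int) => \1_A i : R)
  | ZAdd => ap2 (fun i j : int => i + j)
  | ZOpp => ap1 (fun i : int => - i)
  | AUnion => ap2 (fun A B : set int => A `|` B)
  | AInter => ap2 (fun A B : set int => A `&` B)
  | ACompl => ap1 (fun A : set int => ~` A)
  | BanAdd b => ap2 (fun u v : banach_space b => u + v)
  | BanScale b => ap2 (fun (a : R) (v : banach_space b) => a *: v)
  | BanNorm b => ap1 (fun v : banach_space b => `|v|)
  | HInner => ap2 (fun x y : H => inner H x y)
  | LInner X => ap2 (@linf_inner R H (dom_type X))
  | LAbs X => ap1 (@linf_pnorm R (dom_type X) R^o)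
  | LMax X => ap2 (@linf_max R (dom_type X))
  | LMin X => ap2 (@linf_min R (dom_type X))
  | MTV => ap1 (@tv_meas R)
  | MMax => ap2 (@max_meas R)
  | MMin => ap2 (@min_meas R)
  | LNorm X Y => ap1 (@linf_pnorm R (dom_type X) (val_space Y))
  | LMNorm => ap1 (@linf_pnorm R int (meas R))
  | BAdj => ap1 (@adj R H)
  | BComp => ap2 (@bop_comp R H)
  | LAdj X => ap1 (@linf_adj R H (dom_type X))
  | LComp X => ap2 (@linf_comp R (dom_type X) H)
  | ZSing => ap1 (fun i : int => [set i])
  | AChi => ap1 (@linf_indic R)
  | ZDirac => ap1 (@dirac_meas R)
  | LCst X Y => ap1 (fun v => linf_cst (dom_type X) (to_val (Y := Y) v))
  | LMCst => ap1 (@linf_cst R int (meas R))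
  | LSnd Y => ap1 (fun f : L1 Y => linf_precomp snd f : L2 Y)
  | LFst Y => ap1 (fun f : L1 Y => linf_precomp fst f : L2 Y)
  | BEval => ap2 (fun (T : bop H) (x : H) => T x)
  | LEval1 Y => ap2 (fun (f : L1 Y) (i : int) => of_val (f i))
  | LEval2 Y => ap3 (fun (F : L2 Y) (i j : int) => of_val (F (i, j)))
  | LMEval => ap2 (fun (nu : linf int (meas R)) (i : int) => nu i)
  | LApp X => ap2 (@linf_app R (dom_type X) H)
  | LRow Y => ap2 (fun (F : L2 Y) (i : int) =>
      linf_precomp (fun j => (i, j)) F : L1 Y)
  | LCol Y => ap2 (fun (F : L2 Y) (j : int) =>
      linf_precomp (fun i => (i, j)) F : L1 Y)
  | Sigma => ap1 (@sigma_meas R)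
  | LTrans Y => ap1 (fun f : L1 Y =>
      linf_precomp (fun p : int * int => p.1 + p.2) f : L2 Y)
  | LShear Y => ap1 (fun F : L2 Y =>
      linf_precomp (fun p : int * int => (p.1, p.1 + p.2)) F : L2 Y)
  | LSwap Y => ap1 (fun F : L2 Y =>
      linf_precomp (fun p : int * int => (p.2, p.1)) F : L2 Y)
  | MTrans => ap1 (@mtrans R)
  | Int Y => ap2 (fun (f : L1 Y) (mu : meas R) => of_val (integ f mu))
  | IntM => ap2 (fun (nu : linf int (meas R)) (mu : meas R) => integ nu mu)
  | IntL Y => ap2 (@integL R (val_space Y))
  | IntR Y => ap2 (@integR R (val_space Y))
  | IntD Y => ap2 (@integD R (val_space Y))
  end.

Definition classical_PET : structure R pet_lang :=
  @Structure R pet_lang classical_nonreal classical_anchor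
    classical_const classical_func.

End classical.

Definition PET_theory (R : realType) : sentence pet_lang -> Prop :=
  theory (fun M : structure R pet_lang => exists H : hilbert R,
    M = classical_PET H).

Definition PET_structure (R : realType) (M : structure R pet_lang) : Prop :=
  henson_structure M /\ model M (@PET_theory R).

(* Completeness is not a consequence of the theory: a dense elementary
   substructure of a model is a model. *)
Definition complete_sort (R : realType) (M : structure R pet_lang)
    (s : hsort pet_sort) : Prop :=
  forall F : set_system (carrier M s), ProperFilter F -> cauchy F ->
    exists l : carrier M s, F --> l.

Section leibman.
Context {R : realType} (M : structure R pet_lang).
Local Notation "s ^M" := (carrier M s) (at level 2, format "s ^M").

Definition addZ (i j : sZ^M) : sZ^M := @func_interp _ _ M ZAdd (i, (j, tt)).
Definition idB : sB^M := @const_interp _ _ M CId.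
Definition compB (S T : sB^M) : sB^M := @func_interp _ _ M BComp (S, (T, tt)).
Definition adjB (T : sB^M) : sB^M := @func_interp _ _ M BAdj (T, tt).
Definition evalB (T : sB^M) (x : sH^M) : sH^M :=
  @func_interp _ _ M BEval (T, (x, tt)).
Definition evalL (T : (sL DZ VB)^M) (i : sZ^M) : sB^M :=
  @func_interp _ _ M (LEval1 VB) (T, (i, tt)).
Definition stdN (n : nat) : sN^M := @const_interp _ _ M (CN n).

(* Elements of the sort L^oo_{Z,B} being identified with functions by means of
   evaluation, Delta^i is defined on all functions Z^M -> B^M. *)
Definition Delta (i : sZ^M) (T : sZ^M -> sB^M) : sZ^M -> sB^M :=
  fun j => compB (T (addZ i j)) (adjB (T j)).

(* [foldl _ T [:: i_0; ..; i_d]] is Delta^{i_d} ... Delta^{i_0} T. *)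
Definition unitary_leibman_deg (d : nat) (T : (sL DZ VB)^M) : Prop :=
  (forall i, compB (adjB (evalL T i)) (evalL T i) = idB /\
             compB (evalL T i) (adjB (evalL T i)) = idB) /\
  (forall (s : d.+1.-tuple sZ^M) (j : sZ^M),
     foldl (fun f i => Delta i f) (evalL T) s j = idB).

Definition unitary_leibman (T : (sL DZ VB)^M) : Prop :=
  exists d : nat, unitary_leibman_deg d T.

Definition AV (n : sN^M) (T : (sL DZ VB)^M) : sB^M :=
  @func_interp _ _ M (Int VB) (T, (@func_interp _ _ M Sigma (n, tt), tt)).

End leibman.

(* Main.v *)
Require Import Defs.
From HB Require Import structures.
From mathcomp Require Import all_boot all_order all_algebra.
From mathcomp Require Import all_classical all_reals all_analysis.
From mathcomp Require Import ring lra zify.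
Import Order.TTheory GRing.Theory Num.Theory.
Import numFieldNormedType.Exports.

(* Only the standard indices matter: the sort H is a Hilbert space on which the
   operators T_i, for i a standard integer, form a Leibman sequence, and the
   averages along them are the usual ones, because all this is expressed by
   equations that hold in every classical structure.

   That Leibman averages converge is proved by induction on the degree. If they
   do not converge on x, then x correlates with z = AV_N T^* y, where
   y = AV_N T x and N is large. Up to a small error T_k z is the average over
   n <= N of T_k T_{n+k}^* y, and T_k T_{n+k}^* = (Delta^{-n} T)_{n+k} has lower
   degree in k, so that T has convergent averages on z. To make sense of "N
   large", and to apply the induction hypothesis to all n at once, the statement
   is proved for families of sequences in the seminorm given by a finitely
   additive mean over the index set; new means are obtained from old ones by
   averaging over n <= N and taking an ultralimit as N goes to infinity. *)

Set Implicit Arguments.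
Unset Strict Implicit.
Unset Printing Implicit Defensive.

Local Open Scope classical_set_scope.
Local Open Scope ring_scope.

(** * Semi-inner products and averages *)

(** The ambient space is a bare [lmodType], so that the sort H of an abstract structure qualifies;
    its metric is compared with [sqn] only at the end. *)
Record semi_inner (R : realType) (H : lmodType R) := SemiInner {
  ip :> H -> H -> R ;
  ipC : forall x y, ip x y = ip y x ;
  ipDl : forall x y z, ip (x + y) z = ip x z + ip y z ;
  ipZl : forall a x y, ip (a *: x) y = a * ip x y ;
  ip_ge0 : forall x, 0 <= ip x x }.

Section semi_inner_theory.
Context {R : realType} {H : lmodType R} (B : semi_inner H).
Implicit Types (x y z : H) (u v : nat -> H) (N : nat).

Definition sqn x := B x x.

Lemma ipDr x y z : B x (y + z) = B x y + B x z.
Proof. by rewrite ipC ipDl !(ipC B x). Qed.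

Lemma ipZr a x y : B x (a *: y) = a * B x y.
Proof. by rewrite ipC ipZl ipC. Qed.

Lemma ipNl x y : B (- x) y = - B x y.
Proof. by rewrite -scaleN1r ipZl mulN1r. Qed.

Lemma ipNr x y : B x (- y) = - B x y.
Proof. by rewrite ipC ipNl ipC. Qed.

Lemma ip0l y : B 0 y = 0.
Proof. by rewrite -(scale0r y) ipZl mul0r. Qed.

Lemma ip_suml (I : Type) (r : seq I) (F : I -> H) y :
  B (\sum_(i <- r) F i) y = \sum_(i <- r) B (F i) y.
Proof.
by elim/big_rec2 : _ => [|i a b _ <-]; rewrite ?ip0l ?ipDl.
Qed.

Lemma ip_sumr (I : Type) (r : seq I) (F : I -> H) y :
  B y (\sum_(i <- r) F i) = \sum_(i <- r) B y (F i).
Proof. by rewrite ipC ip_suml; apply: eq_bigr => i _; rewrite ipC. Qed.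

Lemma sqn_ge0 x : 0 <= sqn x. Proof. exact: ip_ge0. Qed.

Lemma sqn0 : sqn 0 = 0. Proof. exact: ip0l. Qed.

Lemma sqnZ a x : sqn (a *: x) = a ^+ 2 * sqn x.
Proof. by rewrite /sqn ipZl ipZr mulrA. Qed.

Lemma sqnN x : sqn (- x) = sqn x.
Proof. by rewrite /sqn ipNl ipNr opprK. Qed.

Lemma sqnB x y : sqn (x - y) = sqn x - 2 * B x y + sqn y.
Proof. rewrite /sqn !ipDl !ipDr !ipNl !ipNr (ipC B y x); ring. Qed.

Lemma sqnD x y : sqn (x + y) = sqn x + 2 * B x y + sqn y.
Proof. rewrite /sqn !ipDl !ipDr (ipC B y x); ring. Qed.

(** Expanding [0 <= sqn (s *: x - y)] bounds [2 * B x y] by [s * sqn x + s^-1 * sqn y]. A small [s]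
    keeps the first coefficient close to 1. *)
Lemma sqnD_le (s : R) x y : 0 < s ->
  sqn (x + y) <= (1 + s) * sqn x + (1 + s^-1) * sqn y.
Proof.
move=> s0; have := sqn_ge0 (s *: x - y).
rewrite sqnB sqnZ ipZl => h.
have h' : 2 * B x y <= s * sqn x + s^-1 * sqn y.
  rewrite -(ler_pM2l s0) [leRHS]mulrDr !mulrA mulfV ?gt_eqF// mul1r -expr2.
  lra.
rewrite sqnD; lra.
Qed.

Lemma sqnD_le2 x y : sqn (x + y) <= 2 * sqn x + 2 * sqn y.
Proof.
have := @sqnD_le 1 x y ltr01; rewrite invr1; have -> : 1 + 1 = 2 :> R by ring.
by [].
Qed.

Lemma sqn_sum_le n u : sqn (\sum_(k < n) u k) <= n%:R * \sum_(k < n) sqn (u k).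
Proof.
elim: n => [|n IH]; first by rewrite !big_ord0 sqn0 mul0r.
have [->|n0] := eqVneq n 0%N; first by rewrite !big_ord1 mul1r.
have n0' : 0 < (n%:R : R) by rewrite ltr0n lt0n.
(* The weight 1/n turns both (1 + 1/n) n and 1 + n into n + 1. *)
rewrite !big_ord_recr/= (le_trans (sqnD_le _ _ (_ : 0 < n%:R^-1)))// ?invr_gt0//.
rewrite invrK -natr1 mulrDr (addrC 1 n%:R) lerD2r.
have -> : n%:R + 1 = (1 + n%:R^-1) * n%:R :> R.
  by rewrite mulrDl mulVf ?gt_eqF// mul1r.
by rewrite -mulrA ler_wpM2l// addr_ge0// invr_ge0 ltW.
Qed.

Definition avg N u : H := N.+1%:R^-1 *: \sum_(k < N.+1) u k.

Lemma sqn_avg N u : sqn (avg N u) <= N.+1%:R^-1 * \sum_(k < N.+1) sqn (u k).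
Proof.
rewrite /avg sqnZ.
apply: le_trans (_ : _ <= N.+1%:R^-1 ^+ 2 * (N.+1%:R * \sum_(k < N.+1) sqn (u k))) _.
  by rewrite ler_wpM2l// ?sqr_ge0// sqn_sum_le.
by rewrite expr2 -!mulrA mulKf// pnatr_eq0.
Qed.

Lemma mean_le N (F : nat -> R) C : (forall k, (k <= N)%N -> F k <= C) ->
  N.+1%:R^-1 * \sum_(k < N.+1) F k <= C.
Proof.
move=> FC; rewrite ler_pdivrMl ?ltr0Sn//.
apply: le_trans (_ : _ <= \sum_(k < N.+1) C) _.
  by apply: ler_sum => k _; apply: FC; rewrite -ltnS.
by rewrite sumr_const card_ord -[C *+ _]mulr_natl.
Qed.

Lemma sqn_avg_le N u C : (forall k, (k <= N)%N -> sqn (u k) <= C) ->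
  sqn (avg N u) <= C.
Proof.
move=> uC; apply: le_trans (sqn_avg _ _) _.
exact: (@mean_le _ (fun k => sqn (u k))) uC.
Qed.

Lemma avgD N u v : avg N (fun k => u k + v k) = avg N u + avg N v.
Proof. by rewrite /avg big_split scalerDr. Qed.

Lemma avgN N u : avg N (fun k => - u k) = - avg N u.
Proof. by rewrite /avg sumrN scalerN. Qed.

Lemma avgZ N a u : avg N (fun k => a *: u k) = a *: avg N u.
Proof. by rewrite /avg -scaler_sumr !scalerA mulrC. Qed.

Lemma avgC N M (u : nat -> nat -> H) :
  avg N (fun n => avg M (u n)) = avg M (fun m => avg N (u^~ m)).
Proof.
rewrite /avg -!scaler_sumr exchange_big/= !scalerA mulrC.
by [].
Qed.

Lemma ip_avgl N u y : B (avg N u) y = N.+1%:R^-1 * \sum_(k < N.+1) B (u k) y.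
Proof. by rewrite /avg ipZl ip_suml. Qed.

Lemma ip_avgr N u y : B y (avg N u) = N.+1%:R^-1 * \sum_(k < N.+1) B y (u k).
Proof. by rewrite /avg ipZr ip_sumr. Qed.

(** The sums over [0, N] and [k, N + k] differ by at most k terms on either side, so the averages
    differ by k bounded differences divided by N + 1. Of the resulting (N + 1)^-2 only one factor is
    kept. *)
Lemma avg_shift N k u C : (forall n, sqn (u n) <= C) ->
  sqn (avg N u - avg N (fun n => u (n + k)%N)) <= 4 * C * k%:R ^+ 2 / N.+1%:R.
Proof.
move=> uC; have C0 : 0 <= C := le_trans (sqn_ge0 _) (uC 0%N).
have sE : \sum_(n < N.+1) u n - \sum_(n < N.+1) u (n + k)%N =
    \sum_(n < k) (u n - u (n + N.+1)%N).
  rewrite sumrB; apply/eqP; rewrite subr_eq addrAC eq_sym subr_eq; apply/eqP.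
  have e (p r : nat) : \sum_(i < p) u i + \sum_(i < r) u (i + p)%N =
      \sum_(i < p + r) u i.
    rewrite big_split_ord/=; congr (_ + _).
    by apply: eq_bigr => i _; rewrite addnC.
  by rewrite e addnC -e.
rewrite /avg -scalerBr sE sqnZ.
have h : sqn (\sum_(n < k) (u n - u (n + N.+1)%N)) <= 4 * C * k%:R ^+ 2.
  apply: le_trans (sqn_sum_le _ (fun n => u n - u (n + N.+1)%N)) _.
  apply: le_trans (_ : _ <= k%:R * \sum_(n < k) (4 * C)) _.
    rewrite ler_wpM2l//; apply: ler_sum => n _.
    rewrite (le_trans (sqnD_le2 _ _))// sqnN.
    have := uC n; have := uC (n + N.+1)%N; lra.
  by rewrite sumr_const card_ord -[(4 * C) *+ _]mulr_natl mulrA -expr2 mulrC.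
rewrite mulrC; apply: ler_pM => //; rewrite ?sqn_ge0 ?sqr_ge0//.
rewrite expr2 ler_piMr ?invr_ge0// invf_le1 ?ltr0Sn//.
by rewrite ler1n.
Qed.

End semi_inner_theory.

(** * Unitary Leibman sequences *)

Section unitary_sequences.
Context {R : realType} {H : lmodType R} (B : semi_inner H).

(** The inverse is carried as data and takes the place of the adjoint ([uf_adj]), whose existence a
    semi-inner product alone does not provide. *)
Record unitary := Unitary {
  uf :> H -> H ;
  uinv : H -> H ;
  ufD : forall x y, uf (x + y) = uf x + uf y ;
  ufZ : forall a x, uf (a *: x) = a *: uf x ;
  ufK : cancel uf uinv ;
  uinvK : cancel uinv uf ;
  uf_ip : forall x y, B (uf x) (uf y) = B x y }.

Implicit Types (S T U : unitary).

Lemma uinvD U x y : uinv U (x + y) = uinv U x + uinv U y.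
Proof. by apply: (can_inj (ufK U)); rewrite ufD !uinvK. Qed.

Lemma uinvZ U a x : uinv U (a *: x) = a *: uinv U x.
Proof. by apply: (can_inj (ufK U)); rewrite ufZ !uinvK. Qed.

Lemma uinv_ip U x y : B (uinv U x) (uinv U y) = B x y.
Proof. by rewrite -(uf_ip U) !uinvK. Qed.

Lemma uf_adj U x y : B (U x) y = B x (uinv U y).
Proof. by rewrite -[y in LHS](uinvK U) uf_ip. Qed.

Lemma ufN U x : U (- x) = - U x.
Proof. by rewrite -scaleN1r ufZ scaleN1r. Qed.

Lemma uf_sqn U x : sqn B (U x) = sqn B x.
Proof. exact: uf_ip. Qed.

Lemma uinv_sqn U x : sqn B (uinv U x) = sqn B x.
Proof. exact: uinv_ip. Qed.

Lemma uf_sum U (I : Type) (r : seq I) (F : I -> H) :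
  U (\sum_(i <- r) F i) = \sum_(i <- r) U (F i).
Proof.
elim/big_rec2 : _ => [|i a b _ <-]; last by rewrite ufD.
by rewrite -(scale0r (0 : H)) ufZ !scale0r.
Qed.

Lemma uf_avg U N (u : nat -> H) : U (avg N u) = avg N (fun k => U (u k)).
Proof. by rewrite /avg ufZ uf_sum. Qed.

Lemma udiv_D S T x y :
  S (uinv T (x + y)) = S (uinv T x) + S (uinv T y).
Proof. by rewrite uinvD ufD. Qed.

Lemma udiv_Z S T a x : S (uinv T (a *: x)) = a *: S (uinv T x).
Proof. by rewrite uinvZ ufZ. Qed.

Lemma udiv_K S T : cancel (fun x => S (uinv T x)) (fun x => T (uinv S x)).
Proof. by move=> x; rewrite ufK uinvK. Qed.

Lemma udiv_ip S T x y : B (S (uinv T x)) (S (uinv T y)) = B x y.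
Proof. by rewrite uf_ip uinv_ip. Qed.

Definition udiv S T : unitary :=
  Unitary (udiv_D S T) (udiv_Z S T) (udiv_K S T) (udiv_K T S) (udiv_ip S T).

Definition udelta (i : int) (T : int -> unitary) (j : int) : unitary :=
  udiv (T (i + j)) (T j).

(* Degree at most d - 1 in the paper's numbering. *)
Fixpoint uleibman (d : nat) (T : int -> unitary) : Prop :=
  if d is d'.+1 then forall i, uleibman d' (udelta i T)
  else forall j x, T j x = x.

(** Translation commutes with the difference operators [udelta i]. *)
Lemma uleibman_shift d (T : int -> unitary) n :
  uleibman d T -> uleibman d (fun k => T (n + k)).
Proof.
elim: d T => [|d IH] T /= hT; first by move=> j x; exact: hT.
move=> i; have -> : udelta i (fun k => T (n + k)) =
    (fun k => udelta i T (n + k)).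
  by apply/funext => j; rewrite /udelta addrCA.
exact: IH.
Qed.

Definition uavg (T : int -> unitary) N x : H := avg N (fun k => T k%:Z x).

Definition uavg_adj (T : int -> unitary) N x : H :=
  avg N (fun k => uinv (T k%:Z) x).

Lemma uavg_adjE (T : int -> unitary) N x y : B (uavg T N x) y = B x (uavg_adj T N y).
Proof.
rewrite /uavg /uavg_adj ip_avgl ip_avgr; congr (_ * _).
by apply: eq_bigr => k _; rewrite uf_adj.
Qed.

Lemma sqn_uavg (T : int -> unitary) N x : sqn B (uavg T N x) <= sqn B x.
Proof. by apply: sqn_avg_le => k _; rewrite uf_sqn. Qed.

Lemma sqn_uavg_adj (T : int -> unitary) N x : sqn B (uavg_adj T N x) <= sqn B x.
Proof. by apply: sqn_avg_le => k _; rewrite uinv_sqn. Qed.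

Lemma uavgD (T : int -> unitary) N x y : uavg T N (x + y) = uavg T N x + uavg T N y.
Proof.
by rewrite /uavg -avgD; congr avg; apply/funext => k; rewrite ufD.
Qed.

Lemma uavgZ (T : int -> unitary) N a x : uavg T N (a *: x) = a *: uavg T N x.
Proof.
by rewrite /uavg -avgZ; congr avg; apply/funext => k; rewrite ufZ.
Qed.

Definition uosc (T : int -> unitary) N M x : H := uavg T N x - uavg T M x.

Lemma uoscD (T : int -> unitary) N M x y : uosc T N M (x + y) = uosc T N M x + uosc T N M y.
Proof. by rewrite /uosc !uavgD opprD addrACA. Qed.

Lemma uoscZ (T : int -> unitary) N M a x : uosc T N M (a *: x) = a *: uosc T N M x.
Proof. by rewrite /uosc !uavgZ scalerBr. Qed.

Lemma sqn_uosc (T : int -> unitary) N M x : sqn B (uosc T N M x) <= 4 * sqn B x.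
Proof.
rewrite (le_trans (sqnD_le2 _ _ _))// sqnN.
have := sqn_uavg T N x; have := sqn_uavg T M x; lra.
Qed.

(* T_k T_{n+k}^-1, the inverse of (Delta^n T)_k, is again a difference of T,
   namely (Delta^{-n} T)_{n+k}; this is why averages of T on vectors of the form
   uavg_adj T N y are controlled by sequences of lower degree. *)
Definition back_delta (T : int -> unitary) (n : nat) (k : int) : unitary :=
  udelta (- n%:Z) T (n%:Z + k).

Lemma back_deltaE (T : int -> unitary) n k x : back_delta T n k x = T k (uinv (T (n%:Z + k)) x).
Proof. by rewrite /back_delta /udelta/= addKr. Qed.

Lemma uleibman_back d (T : int -> unitary) n : uleibman d.+1 T -> uleibman d (back_delta T n).
Proof. by move=> hT; apply: uleibman_shift; exact: hT. Qed.

(** Since T_k preserves the form, T_k applied to the average of T_n^-1 y differs from the average of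
    T_k T_{n+k}^-1 y only by a shift by k <= M, which [avg_shift] bounds. The error vanishes as N
    grows with M fixed. *)
Lemma uavg_uavg_adj_approx (T : int -> unitary) N M y :
  sqn B (uavg T M (uavg_adj T N y) - avg N (fun n => uavg (back_delta T n) M y))
    <= 4 * sqn B y * M%:R ^+ 2 / N.+1%:R.
Proof.
(* With the average over k outside, each k <= M can be treated separately. *)
have -> : avg N (fun n => uavg (back_delta T n) M y) =
    avg M (fun k => avg N (fun n => back_delta T n k%:Z y)) by rewrite /uavg avgC.
rewrite /uavg -avgN -avgD; apply: sqn_avg_le => k kM.
have -> : avg N (fun n => back_delta T n k%:Z y) =
    T k%:Z (avg N (fun n => uinv (T (n + k)%N%:Z) y)).
  by rewrite uf_avg; congr avg; apply/funext => n; rewrite back_deltaE PoszD.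
rewrite -ufN -ufD uf_sqn /uavg_adj.
apply: le_trans (@avg_shift _ _ B N k (fun n => uinv (T n%:Z) y) (sqn B y) _) _.
  by move=> n; rewrite uinv_sqn.
rewrite ler_wpM2r ?invr_ge0// ler_wpM2l ?mulr_ge0 ?sqn_ge0//.
by rewrite lerXn2r ?nnegrE// ler_nat.
Qed.

(** Replacing both averages by their approximations leaves an average over n <= N of oscillations of
    the lower-degree sequences [back_delta T n]; [sqn_avg] moves [sqn] inside it. *)
Lemma uosc_uavg_adj_le (T : int -> unitary) N M M' y :
  sqn B (uosc T M M' (uavg_adj T N y)) <=
    2 * (N.+1%:R^-1 * \sum_(n < N.+1) sqn B (uosc (back_delta T n) M M' y)) +
    16 * sqn B y * (M%:R ^+ 2 + M'%:R ^+ 2) / N.+1%:R.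
Proof.
rewrite {1}/uosc.
set a := uavg T M _; set a' := uavg T M' _.
pose b K := avg N (fun n => uavg (back_delta T n) K y).
have abE : a - a' = (b M - b M') + ((a - b M) - (a' - b M')).
  have -> : (a - b M) - (a' - b M') = (a - a') - (b M - b M').
    by rewrite !opprB addrACA [RHS]addrACA [- b M - _]addrC.
  by rewrite [RHS]addrC subrK.
rewrite abE (le_trans (sqnD_le2 _ _ _))//.
apply: lerD.
  rewrite ler_wpM2l// /b -avgN -avgD; exact: sqn_avg.
apply: le_trans (_ : _ <= 2 * (2 * sqn B (a - b M) + 2 * sqn B (a' - b M'))) _.
  by rewrite ler_wpM2l// (le_trans (sqnD_le2 _ _ _))// sqnN.
have := uavg_uavg_adj_approx T N M y; have := uavg_uavg_adj_approx T N M' y.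
rewrite -/a -/a' -/(b M) -/(b M') => h1 h2.
have -> : 16 * sqn B y * (M%:R ^+ 2 + M'%:R ^+ 2) / N.+1%:R =
    4 * (4 * sqn B y * M%:R ^+ 2 / N.+1%:R) +
    4 * (4 * sqn B y * M'%:R ^+ 2 / N.+1%:R) by ring.
move: h1 h2; move: (4 * _ * M'%:R ^+ 2 / _) (4 * _ * M%:R ^+ 2 / _) => p p'.
move: (sqn B _) (sqn B _) => r r'.
lra.
Qed.

End unitary_sequences.

(** * Finitely additive means *)

Section means.
Context {R : realType}.

Definition bnd (I : Type) (f : I -> R) : Prop := exists C, forall i, `|f i| <= C.

Lemma bndD I (f g : I -> R) : bnd f -> bnd g -> bnd (fun i => f i + g i).
Proof.
move=> [C fC] [D gD]; exists (C + D) => i.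
by rewrite (le_trans (ler_normD _ _))// lerD.
Qed.

Lemma bndZ I (f : I -> R) c : bnd f -> bnd (fun i => c * f i).
Proof.
by move=> [C fC]; exists (`|c| * C) => i; rewrite normrM ler_wpM2l.
Qed.

Lemma bnd_ge0 I (f : I -> R) C : (forall i, 0 <= f i <= C) -> bnd f.
Proof. by move=> fC; exists C => i; have /andP[f0 ?] := fC i; rewrite ger0_norm. Qed.

Lemma bnd_comp I J (f : I -> R) (g : J -> I) : bnd f -> bnd (fun j => f (g j)).
Proof. by move=> [C fC]; exists C => j. Qed.

(** Positive normalized linear functionals on bounded functions. As [m] is a total function,
    linearity and positivity are asked for bounded arguments only. *)
Record is_mean (I : Type) (m : (I -> R) -> R) : Prop := IsMean {
  meanD : forall f g, bnd f -> bnd g -> m (fun i => f i + g i) = m f + m g ;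
  meanZ : forall c f, bnd f -> m (fun i => c * f i) = c * m f ;
  mean_ge0 : forall f, bnd f -> (forall i, 0 <= f i) -> 0 <= m f ;
  mean1 : m (fun=> 1) = 1 }.

Section mean_theory.
Context (I : Type) (m : (I -> R) -> R) (mm : is_mean m).

Lemma bnd_cst c : bnd (fun _ : I => c). Proof. by exists `|c|. Qed.

Lemma mean_cst c : m (fun=> c) = c.
Proof.
have := meanZ mm c (bnd_cst 1); rewrite (mean1 mm) mulr1.
by [].

Qed.

Lemma mean_mono f g : bnd f -> bnd g -> (forall i, f i <= g i) -> m f <= m g.
Proof.
move=> bf bg fg; have bNf := bndZ (-1) bf.
have := mean_ge0 mm (bndD bg bNf); rewrite (meanD mm)// (meanZ mm)// mulN1r subr_ge0.
by apply=> i; rewrite mulN1r subr_ge0.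
Qed.

Lemma mean_bnd f C : (forall i, `|f i| <= C) -> `|m f| <= C.
Proof.
move=> fC; have bf : bnd f by exists C.
rewrite ler_norml; apply/andP; split.
  rewrite -[leLHS]mean_cst; apply: mean_mono => // [|i]; first exact: bnd_cst.
  by have := fC i; rewrite ler_norml => /andP[].
rewrite -[leRHS]mean_cst; apply: mean_mono => // [|i]; first exact: bnd_cst.
by have := fC i; rewrite ler_norml => /andP[].
Qed.

End mean_theory.

Lemma bnd_mean I J (m : (I -> R) -> R) (f : I * J -> R) : is_mean m -> bnd f ->
  bnd (fun j => m (fun i => f (i, j))).
Proof. by move=> mm [C fC]; exists C => j; apply: mean_bnd. Qed.

(** * Ultralimits of bounded real sequences *)

Definition nat_ultra : set_system nat := sval (cid (ultraFilterLemma (F := \oo) _)).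

Lemma nat_ultraP : UltraFilter nat_ultra /\ \oo `<=` nat_ultra.
Proof. exact: (svalP (cid (ultraFilterLemma (F := \oo) _))). Qed.

#[local] Instance nat_ultra_ultra : UltraFilter nat_ultra.
Proof. by have [] := nat_ultraP. Qed.

Definition ulim (f : nat -> R) : R := lim (f @ nat_ultra).

(** By compactness of [-C, C] the image filter has a cluster point, and an ultrafilter converges to
    each of its cluster points. *)
Lemma ulim_cvg f : bnd f -> f @ nat_ultra --> ulim f.
Proof.
move=> [C fC]; have cC : compact `[- C, C]%classic by exact: segment_compact.
have [|l [_ fl]] := cC (f @ nat_ultra) _.
  rewrite /nbhs/=; apply: (@filterE _ nat_ultra) => n.
  by rewrite /= in_itv/= -ler_norml.
apply/cvg_ex; exists l => V Vl.
have [//|nV] := in_ultra_setVsetC (f @^-1` V) nat_ultra_ultra.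
have [x []] := fl _ _ (nV : (f @ nat_ultra) (~` V)) Vl; by [].
Qed.

Lemma ulimD f g : bnd f -> bnd g -> ulim (fun n => f n + g n) = ulim f + ulim g.
Proof. by move=> bf bg; apply/cvg_lim => //; apply: cvgD; exact: ulim_cvg. Qed.

Lemma ulimZ c f : bnd f -> ulim (fun n => c * f n) = c * ulim f.
Proof. by move=> bf; apply/cvg_lim => //; apply: cvgMr; exact: ulim_cvg. Qed.

Lemma ulim_ge f c : bnd f -> (\forall n \near \oo, c <= f n) -> c <= ulim f.
Proof.
move=> bf cf; apply: limr_ge; first by apply/cvg_ex; exists (ulim f); exact: ulim_cvg.
by have [_] := nat_ultraP; apply.
Qed.

Lemma ulim_cst c : ulim (fun=> c) = c.
Proof. by apply/cvg_lim => //; exact: cvg_cst. Qed.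

Lemma ulim_0 f : bnd f -> f @ \oo --> 0 -> ulim f = 0.
Proof.
move=> bf f0; apply/cvg_lim => //; apply: cvg_trans f0.
by apply: cvg_app; have [_] := nat_ultraP.
Qed.

(** The mean over I is taken at each fixed j and the ultralimit in j comes last, so that errors
    tending to 0 with j disappear. *)
Definition mean_lim I (m : (I -> R) -> R) (f : I * nat -> R) : R :=
  ulim (fun j => m (fun i => f (i, j))).

Lemma is_mean_lim I (m : (I -> R) -> R) : is_mean m -> is_mean (mean_lim m).
Proof.
move=> mm; split.
- move=> f g bf bg; rewrite /mean_lim -ulimD; [|exact: (bnd_mean mm bf)|exact: (bnd_mean mm bg)].
  congr ulim; apply/funext => j.
  by rewrite -(meanD mm)//; apply: bnd_comp.
- move=> c f bf; rewrite /mean_lim -ulimZ; last exact: (bnd_mean mm bf).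
  congr ulim; apply/funext => j.
  by rewrite -(meanZ mm)//; apply: bnd_comp.
- move=> f bf f0; apply: ulim_ge; first exact: (bnd_mean mm bf).
  by near=> j; apply: (mean_ge0 mm) => //; apply: bnd_comp.
- by rewrite /mean_lim (mean1 mm) ulim_cst.
Unshelve. all: by end_near. Qed.

Definition rmean N (f : nat -> R) : R := N.+1%:R^-1 * \sum_(n < N.+1) f n.

Lemma rmean_cst N c : rmean N (fun=> c) = c.
Proof.
by rewrite /rmean sumr_const card_ord -[c *+ _]mulr_natl mulKf// pnatr_eq0.
Qed.

Lemma rmean_le N (f g : nat -> R) : (forall n, f n <= g n) ->
  rmean N f <= rmean N g.
Proof. by move=> fg; rewrite ler_wpM2l ?invr_ge0// ler_sum. Qed.

(** The second index is averaged over n <= N i, a range depending on i; a single mean can thus carry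
    all the sequences [back_delta (T i) n]. *)
Definition mean_avg I (m : (I -> R) -> R) (N : I -> nat) (f : I * nat -> R) : R :=
  m (fun i => rmean (N i) (fun n => f (i, n))).

Lemma bnd_rmean I (N : I -> nat) (f : I * nat -> R) : bnd f ->
  bnd (fun i => rmean (N i) (fun n => f (i, n))).
Proof.
move=> [C fC]; exists C => i; rewrite ler_norml; apply/andP; split.
  rewrite -(rmean_cst (N i) (- C)); apply: rmean_le => n.
  by have := fC (i, n); rewrite ler_norml => /andP[].
rewrite -[leRHS](rmean_cst (N i) C); apply: rmean_le => n.
by have := fC (i, n); rewrite ler_norml => /andP[].
Qed.

Lemma is_mean_avg I (m : (I -> R) -> R) N : is_mean m -> is_mean (mean_avg m N).
Proof.
move=> mm; split.
- move=> f g bf bg; rewrite /mean_avg.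
  rewrite -(meanD mm (bnd_rmean N bf) (bnd_rmean N bg)).
  by congr m; apply/funext => i; rewrite /rmean big_split mulrDr.
- move=> c f bf; rewrite /mean_avg -(meanZ mm c (bnd_rmean N bf)).
  by congr m; apply/funext => i; rewrite /rmean -mulr_sumr mulrCA.
- move=> f bf f0; apply: (mean_ge0 mm (bnd_rmean N bf)) => i.
  by rewrite -(rmean_cst (N i) 0); exact: rmean_le.
- by rewrite /mean_avg -[RHS](mean1 mm); congr m; apply/funext => i; rewrite rmean_cst.
Qed.

Lemma is_mean_unit : is_mean (fun f : unit -> R => f tt).
Proof. by split. Qed.

End means.

(** * The mean ergodic theorem for Leibman sequences *)

Section mean_ergodic.
Context {R : realType} {H : lmodType R} (B : semi_inner H).
Local Notation q := (sqn B).

(** Index type, mean and family are all quantified here because the induction step replaces I by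
    [I * nat] and [I * nat * nat]. *)
Definition mean_cauchy (d : nat) : Prop :=
  forall (I : Type) (m : (I -> R) -> R) (T : I -> int -> unitary B) (x : I -> H),
    is_mean m -> (forall i, uleibman d (T i)) -> bnd (fun i => q (x i)) ->
    forall e : R, 0 < e -> exists N0, forall N M, (N0 <= N)%N -> (N0 <= M)%N ->
      m (fun i => q (uosc (T i) N M (x i))) <= e.

Lemma bnd_sqn_le (I : Type) (x y : I -> H) C : (forall i, q (y i) <= C * q (x i)) ->
  0 <= C -> bnd (fun i => q (x i)) -> bnd (fun i => q (y i)).
Proof.
move=> yx C0 [D xD]; exists (C * D) => i; rewrite ger0_norm ?sqn_ge0//.
by rewrite (le_trans (yx i))// ler_wpM2l// (le_trans (ler_norm _)).
Qed.

Lemma bnd_uosc I (T : I -> int -> unitary B) N M (x : I -> H) :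
  bnd (fun i => q (x i)) -> bnd (fun i => q (uosc (T i) N M (x i))).
Proof. by apply: (@bnd_sqn_le _ x _ 4) => // i; exact: sqn_uosc. Qed.

(** * Dual vectors of averages *)

Section dual_vectors.
Context (I : Type) (m : (I -> R) -> R) (mm : is_mean m).
Context (T : I -> int -> unitary B) (x : I -> H) (N : nat -> nat).
Context (bx : bnd (fun i => q (x i))).

(** The second index j stands for the averaging length [N j]; under [mean_lim], with [N j] at least
    j, it plays the part of a large N. *)
Definition dual_y (p : I * nat) : H := uavg (T p.1) (N p.2) (x p.1).
Definition dual_z (p : I * nat) : H := uavg_adj (T p.1) (N p.2) (dual_y p).

Lemma dual_y_le p : q (dual_y p) <= q (x p.1).
Proof. exact: sqn_uavg. Qed.

Lemma dual_z_le p : q (dual_z p) <= q (x p.1).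
Proof. by rewrite (le_trans (sqn_uavg_adj _ _ _))// dual_y_le. Qed.

Lemma bnd_dual_y : bnd (fun p => q (dual_y p)).
Proof.
apply: (@bnd_sqn_le _ (fun p : I * nat => x p.1) _ 1) => //.
  by move=> p; rewrite mul1r dual_y_le.
exact: (bnd_comp (fun p : I * nat => p.1) bx).
Qed.

Lemma bnd_dual_z : bnd (fun p => q (dual_z p)).
Proof.
apply: (@bnd_sqn_le _ (fun p : I * nat => x p.1) _ 1) => //.
  by move=> p; rewrite mul1r dual_z_le.
exact: (bnd_comp (fun p : I * nat => p.1) bx).
Qed.

(** With A the averaging operator and A' its adjoint, z = A' A x, so x correlates with z by the
    square norm of A x. *)
Lemma ip_dual_z p : B (x p.1) (dual_z p) = q (dual_y p).
Proof. by rewrite -uavg_adjE. Qed.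

(** [uosc_uavg_adj_le] bounds the oscillation of z by the mean over n <= N j of those of
    [back_delta (T i) n] at y. One use of [mean_cauchy d], for a mean over triples (i, j, n),
    controls them all with a single N0. *)
Lemma dual_z_cauchy d : mean_cauchy d -> (forall i, uleibman d.+1 (T i)) ->
  (forall j, (j <= N j)%N) -> forall e : R, 0 < e -> exists N0, forall M M',
    (N0 <= M)%N -> (N0 <= M')%N ->
    mean_lim m (fun p => q (uosc (T p.1) M M' (dual_z p))) <= e.
Proof.
move=> Cd hT jN e e0; have mm' := is_mean_lim mm.
pose N' (p : I * nat) := N p.2.
pose S (r : I * nat * nat) := back_delta (T r.1.1) r.2.
have hS r : uleibman d (S r) by exact: uleibman_back.
have bS : bnd (fun r : I * nat * nat => q (dual_y r.1)).
  exact: (bnd_comp (fun r : I * nat * nat => r.1) bnd_dual_y).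
(* The tolerance e / 2 makes up for the factor 2 in [uosc_uavg_adj_le]. *)
have [|N0 hN0] := Cd _ _ _ _ (is_mean_avg N' mm') hS bS (e / 2).
  by rewrite divr_gt0.
exists N0 => M M' hM hM'; have := hN0 _ _ hM hM'.
rewrite /mean_avg; set A := (fun p : I * nat => rmean _ _) => hA.
have bA : bnd A.
  exact: (@bnd_rmean _ _ N' _ (bnd_uosc S M M' bS)).
have [C xC] := bx.
pose K : R := 16 * C * (M%:R ^+ 2 + M'%:R ^+ 2).
have C0 (p : I * nat) : 0 <= C by exact: le_trans (normr_ge0 _) (xC p.1).
have K0 (p : I * nat) : 0 <= K.
  by rewrite /K mulr_ge0 ?addr_ge0 ?sqr_ge0// mulr_ge0// (C0 p).
(* [D] majorizes the error term of [uosc_uavg_adj_le], since [p.2 <= N p.2]; for fixed M and M' its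
   ultralimit is 0. *)
pose D (p : I * nat) : R := K / p.2.+1%:R.
have Dle p : 0 <= D p <= `|K|.
  rewrite /D divr_ge0 ?(K0 p)//= ger0_norm ?(K0 p)//.
  by rewrite ler_piMr ?(K0 p)// invf_le1 ?ltr0Sn// ler1n.
have bD : bnd D := bnd_ge0 Dle.
have D0 : mean_lim m D = 0.
  apply: ulim_0; first exact: (bnd_mean mm bD).
  rewrite (_ : (fun j => _) = (fun j => K * j.+1%:R^-1)); last first.
    by apply/funext => j; rewrite /D/= (mean_cst mm).
  rewrite -(mulr0 K); apply: cvgMr; exact: cvg_harmonic.
apply: le_trans (_ : _ <= mean_lim m (fun p => 2 * A p + D p)) _.
  apply: (mean_mono mm'); first exact: (bnd_uosc (fun p => T p.1) _ _ bnd_dual_z).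
    by apply: bndD => //; exact: bndZ.
  move=> p; rewrite (le_trans (uosc_uavg_adj_le _ _ _ _ _))// lerD2l /D /K.
  apply: ler_pM; rewrite ?invr_ge0 ?mulr_ge0 ?addr_ge0 ?sqr_ge0 ?sqn_ge0//.
    rewrite ler_wpM2r ?addr_ge0 ?sqr_ge0// ler_wpM2l//.
    by rewrite (le_trans (dual_y_le p))// (le_trans (ler_norm _)).
  by rewrite lef_pV2 ?posrE ?ltr0Sn// ler_nat ltnS.
rewrite (meanD mm')//; last exact: bndZ.
by rewrite (meanZ mm')// D0 addr0 mulrC -ler_pdivlMr.
Qed.

End dual_vectors.

(** Lower bounds for the oscillation at arbitrarily large N and M, over all families of mean square
    at most 1. Once no level is positive, [mean_cauchy d] follows by rescaling. *)
Definition osc_levels (d : nat) : set R := [set g | exists (I : Type)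
  (m : (I -> R) -> R) (T : I -> int -> unitary B) (x : I -> H),
  [/\ is_mean m, forall i, uleibman d (T i), bnd (fun i => q (x i)),
      m (fun i => q (x i)) <= 1 &
      forall N0, exists N M, [/\ (N0 <= N)%N, (N0 <= M)%N &
        g <= m (fun i => q (uosc (T i) N M (x i)))]]].

Lemma osc_levels_le d g : osc_levels d g -> g <= 4.
Proof.
move=> [I [m [T [x [mm hT bx x1 /(_ 0%N)[N [M [_ _ /le_trans]]]]]]]]; apply.
apply: le_trans (_ : _ <= m (fun i => 4 * q (x i))) _.
  apply: (mean_mono mm); [exact: bnd_uosc|exact: bndZ|].
  by move=> i; exact: sqn_uosc.
by rewrite (meanZ mm)// -[leRHS]mulr1 ler_wpM2l.
Qed.

(* Subtracting from x a small multiple of the dual vector z shrinks the norm of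
   x without changing its oscillation, so that rescaling increases the latter. *)
Lemma osc_levels_gain d g : mean_cauchy d -> osc_levels d.+1 g -> 0 < g ->
  osc_levels d.+1 (g * (1 + 3 * g ^+ 2 / 128)).
Proof.
move=> Cd Ag g0.
have g4 := osc_levels_le Ag.
case: Ag => I [m [T [x [mm hT bx x1 oscx]]]].
(* In mean g <= 2 q(AV_n x) + 2 q(AV_n' x), so one of the two averages has mean square at least g /
   4. *)
pose eps := g / 4.
have eps0 : 0 < eps by rewrite divr_gt0.
have /choice[N hN] : forall j, exists n, (j <= n)%N /\
    eps <= m (fun i => q (uavg (T i) n (x i))).
  move=> j.
  have [n [n' [jn jn' gn]]] := oscx j.
  have bu k : bnd (fun i => q (uavg (T i) k (x i))).
    by apply: (@bnd_sqn_le _ x _ 1) => // i; rewrite mul1r sqn_uavg.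
  have : g <= 2 * m (fun i => q (uavg (T i) n (x i))) +
              2 * m (fun i => q (uavg (T i) n' (x i))).
    rewrite -!(meanZ mm)// -(meanD mm); [|exact: bndZ..].
    apply: le_trans gn _; apply: (mean_mono mm); first exact: bnd_uosc.
      by apply: bndD; exact: bndZ.
    by move=> i; rewrite (le_trans (sqnD_le2 _ _ _))// sqnN.
  have [h|h] := leP eps (m (fun i => q (uavg (T i) n (x i)))); first by exists n.
  exists n'; split => //; rewrite /eps in h *; lra.
have jN j : (j <= N j)%N by have [] := hN j.
have mm' := is_mean_lim mm.
pose y := dual_y T x N; pose z := dual_z T x N.
have by_ : bnd (fun p => q (y p)) := bnd_dual_y T N bx.
have bz : bnd (fun p => q (z p)) := bnd_dual_z T N bx.
have bx' : bnd (fun p : I * nat => q (x p.1)).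
  exact: (bnd_comp (fun p : I * nat => p.1) bx).
have mx' : mean_lim m (fun p => q (x p.1)) <= 1.
  by rewrite /mean_lim/= ulim_cst.
have my : eps <= mean_lim m (fun p => q (y p)).
  apply: ulim_ge; first exact: (bnd_mean mm by_).
  by near=> j; have [] := hN j.
have eps1 : eps <= 1 by rewrite /eps; lra.
(* The mean of q(x - t z) is at most 1 - 2 t eps + t^2, which is the [c] below for this [t]. *)
pose t := eps / 2.
have t0 : 0 < t by rewrite divr_gt0.
pose c := 1 - 3 * eps ^+ 2 / 4.
have c0 : 0 < c.
  have : eps ^+ 2 <= 1 by rewrite expr_le1// ltW.
  rewrite /c; lra.
pose x'' (p : I * nat) := x p.1 - t *: z p.
have x''le p : q (x'' p) <= (1 + eps ^+ 2 / 4) * q (x p.1) - eps * q (y p).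
  rewrite /x'' sqnB ipZr sqnZ ip_dual_z -/(y p).
  have h : t ^+ 2 * q (z p) <= t ^+ 2 * q (x p.1).
    by rewrite ler_wpM2l ?sqr_ge0//; exact: dual_z_le.
  have -> : eps ^+ 2 / 4 = t ^+ 2 by rewrite /t; field.
  have -> : eps = 2 * t by rewrite /t; field.
  lra.
have bx'' : bnd (fun p => q (x'' p)).
  have [C xC] := bx'; exists ((1 + eps ^+ 2 / 4) * C) => p.
  rewrite ger0_norm ?sqn_ge0// (le_trans (x''le p))//.
  apply: le_trans (_ : _ <= (1 + eps ^+ 2 / 4) * q (x p.1)) _.
    by rewrite gerBl mulr_ge0 ?sqn_ge0// ltW.
  rewrite ler_wpM2l ?addr_ge0 ?divr_ge0 ?sqr_ge0//.
  by rewrite (le_trans (ler_norm _)).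
have mx'' : mean_lim m (fun p => q (x'' p)) <= c.
  apply: le_trans (_ : _ <= mean_lim m
    (fun p => (1 + eps ^+ 2 / 4) * q (x p.1) + (- eps) * q (y p))) _.
    apply: (mean_mono mm') => //; first by apply: bndD; exact: bndZ.
    by move=> p; rewrite mulNr x''le.
  rewrite (meanD mm'); [|exact: bndZ..].
  rewrite (meanZ mm')// (meanZ mm')//.
  have h1 : (1 + eps ^+ 2 / 4) * mean_lim m (fun p => q (x p.1)) <= 1 + eps ^+ 2 / 4.
    by rewrite ler_piMr// addr_ge0// divr_ge0// sqr_ge0.
  have h2 : eps * eps <= eps * mean_lim m (fun p => q (y p)).
    by rewrite ler_wpM2l// ltW.
  rewrite /c; rewrite -expr2 in h2; lra.
(* Scaling by [s] brings the mean square of [x''] from at most [c] to at most 1. *)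
pose s := (Num.sqrt c)^-1.
have s2 : s ^+ 2 = c^-1 by rewrite /s exprVn sqr_sqrtr// ltW.
exists (I * nat)%type, (mean_lim m), (fun p => T p.1), (fun p => s *: x'' p).
have bs (u : I * nat -> H) : bnd (fun p => q (u p)) ->
    bnd (fun p => q (s *: u p)).
  move=> bu; rewrite (_ : (fun p => _) = (fun p => s ^+ 2 * q (u p))).
    exact: bndZ.
  by apply/funext => p; rewrite sqnZ.
split => //.
- exact: (bs x'' bx'').
- under eq_fun do rewrite sqnZ.
  by rewrite (meanZ mm')// s2 ler_pdivrMl// mulr1.
move=> N0.
pose a := 1 - c.
have aE : a = 3 * g ^+ 2 / 64 by rewrite /a /c /eps; field.
(* [r] will be the weight in [sqnD_le]. The gain to reach is 1 + a / 2, and a / 8 is small enough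
   for (1 + r) (1 - a) (1 + a / 2) <= 1 - r. *)
pose r := a / 8.
have a0 : 0 < a by rewrite aE divr_gt0// mulr_gt0// exprn_gt0.
have r0 : 0 < r by rewrite divr_gt0.
(* With this tolerance on the oscillation of z, the term t z contributes at most r g. *)
pose e0 := r * g / ((1 + r^-1) * t ^+ 2).
have den0 : 0 < (1 + r^-1) * t ^+ 2.
  by rewrite mulr_gt0 ?exprn_gt0// addr_gt0// invr_gt0.
have e00 : 0 < e0 by rewrite divr_gt0// mulr_gt0.
have [N1 hN1] := dual_z_cauchy mm bx Cd hT jN e00.
have [n [k [nN kN gnk]]] := oscx (maxn N0 N1).
move: nN kN; rewrite !geq_max => /andP[nN0 nN1] /andP[kN0 kN1].
exists n, k; split => //.
under eq_fun do rewrite uoscZ sqnZ.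
set F := fun p : I * nat => q (uosc (T p.1) n k (x'' p)).
have bF : bnd F by exact: (bnd_uosc (fun p : I * nat => T p.1)).
rewrite (meanZ mm')// s2.
(* Here x = x'' + t z is split by [sqnD_le], at indices beyond both N0 and N1. *)
have gF : g <= (1 + r) * mean_lim m F + r * g.
  have <- : (1 + r^-1) * t ^+ 2 * e0 = r * g.
    by rewrite /e0 [LHS]mulrC divfK// gt_eqF.
  pose G p := q (uosc (T p.1) n k (z p)).
  have bG : bnd G by exact: (bnd_uosc (fun p : I * nat => T p.1)).
  apply: le_trans (_ : _ <= mean_lim m (fun p => (1 + r) * F p +
      (1 + r^-1) * t ^+ 2 * G p)) _; last first.
    rewrite (meanD mm'); [|exact: bndZ..].
    rewrite (meanZ mm')// (meanZ mm')// lerD2l ler_wpM2l//; first exact: ltW.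
    exact: hN1.
  apply: le_trans (_ : _ <= mean_lim m (fun p => q (uosc (T p.1) n k (x p.1)))) _.
    by rewrite /mean_lim/= ulim_cst.
  apply: (mean_mono mm').
  - exact: (bnd_uosc (fun p : I * nat => T p.1)).
  - by apply: bndD; exact: bndZ.
  - move=> p; rewrite /F /G -[x p.1](subrK (t *: z p)) uoscD -/(x'' p).
    rewrite (le_trans (sqnD_le _ _ _ r0))// lerD2l uoscZ sqnZ.
    by rewrite mulrA.
rewrite ler_pdivlMl//.
have r1 : 0 < 1 + r by rewrite addr_gt0.
rewrite -(ler_pM2l r1); apply: le_trans (_ : _ <= g * (1 - r)) _; last lra.
have -> : (1 + r) * (c * (g * (1 + 3 * g ^+ 2 / 128))) =
   g * ((1 + a / 8) * ((1 - a) * (1 + a / 2))).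
  rewrite (_ : 3 * g ^+ 2 / 128 = a / 2); last by rewrite aE; field.
  by rewrite /r (_ : c = 1 - a); [ring|rewrite /a; ring].
rewrite ler_wpM2l ?(ltW g0)// /r.
have : 0 <= a ^+ 2 by exact: sqr_ge0.
have : 0 <= a ^+ 3 by rewrite exprn_ge0// ltW.
rewrite !exprS expr0 mulr1; nra.
Unshelve. all: by end_near. Qed.

(** A level close enough to a positive supremum would be pushed above it by [osc_levels_gain]. *)
Lemma osc_levels_le0 d g : mean_cauchy d -> osc_levels d.+1 g -> g <= 0.
Proof.
move=> Cd Ag; have [//|g0] := leP g 0; exfalso.
have A0 : has_sup (osc_levels d.+1).
  split; first by exists g.
  by exists 4 => h; exact: osc_levels_le.
set s := sup (osc_levels d.+1).
have sub h : osc_levels d.+1 h -> h <= s.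
  by move=> Ah; apply: ub_le_sup => //; have [] := A0.
pose a := 3 * g ^+ 2 / 128.
have a0 : 0 < a by rewrite divr_gt0// mulr_gt0// exprn_gt0.
have s0 : 0 < s := lt_le_trans g0 (sub _ Ag).
(* Besides being within a factor 1 + a of the supremum, h is taken at least g, so that its own gain
   factor is at least 1 + a. *)
have [h Ah sh] : exists2 h, osc_levels d.+1 h & g <= h /\ s / (1 + a) < h.
  have d0 : 0 < s - s / (1 + a).
    by rewrite subr_gt0 ltr_pdivrMr ?ltr_pMr// ?ltrDl// addr_gt0.
  have [h Ah] := sup_adherent d0 A0; rewrite -/s subKr => sh.
  have [gh|/ltW hg] := leP g h; first by exists h.
  by exists g => //; split => //; exact: lt_le_trans sh hg.
case: sh => gh sh; have h0 := lt_le_trans g0 gh.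
have := sub _ (osc_levels_gain Cd Ah h0); apply/negP; rewrite -ltNge.
rewrite ltr_pdivrMr ?addr_gt0// in sh; apply: lt_le_trans sh _.
rewrite ler_pM2l// lerD2l /a ler_pM2r ?invr_gt0// ler_pM2l//.
by rewrite lerXn2r ?nnegrE// ltW.
Qed.

Lemma mean_cauchyS d : mean_cauchy d -> mean_cauchy d.+1.
Proof.
move=> Cd I m T x mm hT bx e e0; apply: contrapT => ne.
(* [D] is positive and bounds the mean square of x, so dividing x by its square root normalizes the
   family. *)
have [C xC] := bx; pose D := `|C| + 1.
have D0 : 0 < D by rewrite ltr_wpDl.
suff : osc_levels d.+1 (e / D).
  by move=> /(osc_levels_le0 Cd); apply/negP; rewrite -ltNge divr_gt0.
pose s := (Num.sqrt D)^-1.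
have s2 : s ^+ 2 = D^-1 by rewrite /s exprVn sqr_sqrtr// ltW.
exists I, m, T, (fun i => s *: x i).
have sE : (fun i => q (s *: x i)) = (fun i => D^-1 * q (x i)).
  by apply/funext => i; rewrite sqnZ s2.
split => //.
- by rewrite sE; exact: bndZ.
- rewrite sE (meanZ mm)// ler_pdivrMl// mulr1 -(mean_cst mm D).
  apply: (mean_mono mm) => //; first exact: bnd_cst.
  move=> i; rewrite (le_trans (ler_norm _))// (le_trans (xC i))//.
  by rewrite /D (le_trans (ler_norm C))// lerDl.
move=> N0; apply: contrapT => no; apply: ne; exists N0 => N M hN hM.
rewrite leNgt; apply/negP => lt; apply: no; exists N, M; split => //.
under eq_fun do rewrite uoscZ sqnZ s2.
rewrite (meanZ mm); last exact: bnd_uosc.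
by rewrite mulrC ler_wpM2l ?invr_ge0// ltW.
Qed.

Lemma mean_cauchy_all d : mean_cauchy d.
Proof.
elim: d => [|d]; last exact: mean_cauchyS.
move=> I m T x mm hT bx e e0; exists 0%N => N M _ _.
rewrite (_ : (fun i => _) = (fun=> 0)) ?(mean_cst mm) ?ltW//.
apply/funext => i.
have avgE K : uavg (T i) K (x i) = x i.
  rewrite /uavg /avg (eq_bigr (fun=> x i)) => [|k _]; last exact: hT.
  by rewrite sumr_const card_ord -[x i *+ _]scaler_nat scalerA mulVf ?scale1r// pnatr_eq0.
by rewrite /uosc !avgE subrr sqn0.
Qed.

(** A single sequence is a family over [unit], with evaluation at [tt] as mean. *)
Lemma uleibman_cauchy d (T : int -> unitary B) (x : H) : uleibman d T ->
  forall e : R, 0 < e -> exists N0, forall N M, (N0 <= N)%N -> (N0 <= M)%N ->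
    q (uavg T N x - uavg T M x) <= e.
Proof.
move=> hT e e0; have bx : bnd (fun _ : unit => q x) by exact: bnd_cst.
exact: (mean_cauchy_all is_mean_unit (fun=> hT) bx e0).
Qed.

End mean_ergodic.

(** * Classical structures *)

Lemma cauchy_sequence (R : realType) (X : pseudoMetricType R) (u : nat -> X) :
  (forall e : R, 0 < e -> exists N0, forall N, (N0 <= N)%N -> ball (u N0) e (u N)) ->
  cauchy (u @ \oo).
Proof.
move=> h; apply: cauchy_exP => e /h[N0 hN0]; exists (u N0).
by exists N0 => // N /= /hN0.
Qed.

(** * Riesz representation and adjoints in a Hilbert space *)

Section riesz.
Context {R : realType} (H : hilbert R).
Implicit Types (x y z : H).

Lemma innerDl x y z : inner H (x + y) z = inner H x z + inner H y z.
Proof. exact: linearDl. Qed.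

Lemma innerZl a x y : inner H (a *: x) y = a * inner H x y.
Proof. exact: linearZl_LR. Qed.

Lemma inner_ge0 x : 0 <= inner H x x.
Proof. by rewrite inner_norm sqr_ge0. Qed.

Definition hilbert_ip : semi_inner H :=
  SemiInner (@innerC R H) innerDl innerZl inner_ge0.

Lemma sqn_hilbert x : sqn hilbert_ip x = `|x| ^+ 2.
Proof. exact: inner_norm. Qed.

(* The representing vector minimizes |x|^2 - 2 phi(x). *)
Lemma riesz (phi : H -> R) (C : R) :
  (forall a x y, phi (a *: x + y) = a * phi x + phi y) ->
  (forall x, `|phi x| <= C * `|x|) ->
  exists z, forall x, phi x = inner H x z.
Proof.
move=> lphi bphi; pose J x := `|x| ^+ 2 - 2 * phi x.
have phi0 : phi 0 = 0.
  by have := bphi 0; rewrite normr0 mulr0 normr_le0 => /eqP.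
have phiZ a x : phi (a *: x) = a * phi x by rewrite -[a *: x]addr0 lphi phi0 addr0.
have phiD x y : phi (x + y) = phi x + phi y by rewrite -[x]scale1r lphi mul1r scale1r.
have JC x : - C ^+ 2 <= J x.
  rewrite /J; have := sqr_ge0 (`|x| - C).
  have := le_trans (ler_norm _) (bphi x); nra.
have J_inf : has_inf (range J).
  by split; [exists (J 0), 0 | exists (- C ^+ 2) => _ [x _ <-]].
pose i := inf (range J).
have iJ x : i <= J x by apply: ge_inf; [case: J_inf|exists x].
have /choice[u hu] : forall n : nat, exists x, J x <= i + n.+1%:R^-1.
  move=> n; have e0 : 0 < n.+1%:R^-1 :> R by rewrite invr_gt0.
  by have [_ [x _ <-] h] := inf_adherent e0 J_inf; exists x; exact: ltW.
(* Parallelogram law: near-minimizers of [J] are close to each other because [J] at their midpoint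
   is at least the infimum. *)
have para x y : `|x - y| ^+ 2 = 2 * J x + 2 * J y - 4 * J (2^-1 *: (x + y)).
  rewrite /J phiZ phiD -!sqn_hilbert sqnZ sqnB sqnD; by field.
have uc : cauchy (u @ \oo).
  apply: cauchy_sequence => e e0.
  have [N /= hN] : exists N : nat, 4 / N.+1%:R < e ^+ 2.
    have d0 : 0 < e ^+ 2 / 4 by rewrite divr_gt0// exprn_gt0.
    have [N _ /(_ N (leqnn N)) hN] := near_infty_natSinv_lt (PosNum d0).
    by exists N; rewrite mulrC -ltr_pdivlMr.
  exists N => n Nn; rewrite -ball_normE/=.
  rewrite -(@ltr_pXn2r _ 2) ?nnegrE// ?(ltW e0)// para; apply: le_lt_trans hN.
  have := hu N; have := hu n; have := iJ (2^-1 *: (u N + u n)).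
  have : n.+1%:R^-1 <= N.+1%:R^-1 :> R by rewrite lef_pV2 ?posrE// ler_nat.
  by set a := n.+1%:R^-1; set b := N.+1%:R^-1; lra.
have uz : u @ \oo --> lim (u @ \oo) by exact: cauchy_cvg.
move: (lim _) uz => z uz.
exists z => x; apply/eqP; rewrite -subr_eq0 -normr_le0.
apply/ler_addgt0Pl => e e0; rewrite addr0.
(* [D] splits e into t (|x|^2 + 1), from the near-minimality of u n, and |x| t, from the distance of
   u n to z. *)
pose D := `|x| ^+ 2 + 1 + `|x|.
have D0 : 0 < D.
  by rewrite /D -addrA ltr_wpDl ?sqr_ge0// ltr_pwDl.
pose t := e / D.
have t0 : 0 < t by rewrite divr_gt0.
have tt0 : 0 < t ^+ 2 by rewrite exprn_gt0.
near \oo => n.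
have nt : n.+1%:R^-1 < t ^+ 2.
  by near: n; exact: (near_infty_natSinv_lt (PosNum tt0)).
have zn : `|z - u n| < t.
  by near: n; move/cvgrPdist_lt : uz; apply.
(* J (u n) is within t^2 of the infimum, so comparison with J (u n + s x) bounds the first
   variation; s = t and s = - t give both signs. *)
have first_order s : 2 * s * (phi x - inner H x (u n)) <= s ^+ 2 * `|x| ^+ 2 + t ^+ 2.
  have := iJ (u n + s *: x); have := hu n.
  rewrite /J phiD phiZ -!sqn_hilbert sqnD sqnZ ipZr -/(inner H (u n) x).
  rewrite [hilbert_ip _ _]innerC; move: nt.
  move: (phi x) (inner H x _) (_.+1%:R^-1) (phi (u n)) (sqn _ (u n)) => v w r p k.
  move: (sqn _ x) (t ^+ 2) => X t2; nra.
have p1 := first_order t; have p2 := first_order (- t).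
have p3 : `|phi x - inner H x (u n)| <= t * (`|x| ^+ 2 + 1).
  have X0 : 0 <= t ^+ 2 * `|x| ^+ 2 by rewrite mulr_ge0 ?sqr_ge0.
  rewrite ler_norml -(ler_pM2l t0); apply/andP; split.
    rewrite sqrrN in p2; move: p2 X0 (tt0).
    move: (phi x - _) (`|x| ^+ 2) => v w; nra.
  rewrite -(ler_pM2l t0); move: p1 X0 (tt0).
  move: (phi x - _) (`|x| ^+ 2) => v w; nra.
rewrite -(subrK (inner H x (u n)) (phi x)) -addrA.
rewrite (le_trans (ler_normD _ _))//.
have -> : e = t * (`|x| ^+ 2 + 1) + `|x| * t.
  by rewrite mulrC -mulrDl mulrC divfK// gt_eqF.
rewrite lerD// -linearBr/= (le_trans (cauchy_schwarz _ _))// ler_wpM2l//.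
by rewrite distrC ltW.
Unshelve. all: by end_near. Qed.

(** Riesz is applied for each y; linearity follows from uniqueness of the representing vector. *)
Lemma adj_exists (T : bop H) :
  exists S : bop H, forall x y, inner H (T x) y = inner H x (S y).
Proof.
have /choice[S hS] : forall y, exists z, forall x, inner H (T x) y = inner H x z.
  move=> y; apply: (@riesz (fun x => inner H (T x) y) (`|T| * `|y|)).
    by move=> a x x'; rewrite bopD bopZ innerDl innerZl.
  move=> x; rewrite (le_trans (cauchy_schwarz _ _))// mulrAC ler_wpM2r//.
  exact: bop_ub.
have innerI y z : (forall x, inner H x y = inner H x z) -> y = z.
  move=> yz; apply/eqP; rewrite -subr_eq0 -normr_eq0 -sqrf_eq0 -inner_norm.
  by rewrite linearBr/= yz subrr.
have lS : linear S.
  move=> a y y'; apply: innerI => x.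
  by rewrite -hS !linearDr/= !linearZr_LR/= !hS.
have bS y : `|S y| <= `|T| * `|y|.
  have [->|Sy0] := eqVneq (S y) 0; first by rewrite normr0 mulr_ge0.
  rewrite -(@ler_pM2l _ `|S y|) ?normr_gt0// -expr2 -inner_norm -hS.
  rewrite (le_trans (ler_norm _))// (le_trans (cauchy_schwarz _ _))//.
  by rewrite mulrA ler_wpM2r// mulrC bop_ub.
by exists (bop_of lS (ex_intro _ _ bS)).
Qed.

(** [adj] defaults to 0 when no adjoint exists, which [adj_exists] rules out. *)
Lemma adjP (T : bop H) x y : inner H (T x) y = inner H x (adj T y).
Proof.
by rewrite /adj; case: xgetP => [S _ ->//|no]; have [S /no] := adj_exists T.
Qed.

End riesz.

(** * Integration against sigma_n *)

Section classical_averages.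
Context {R : realType}.

Lemma sigma_measE n (i : int) :
  sigma_meas n i = n.+1%:R^-1 * \sum_(j < n.+1) (i == j%:Z)%:R :> R.
Proof.
rewrite /sigma_meas -[LHS]/(_ * (\sum_(j < n.+1) dirac_meas j%:Z : meas R) i).
congr (_ * _).
by elim/big_rec2 : _ => //= j a b _ <-.
Qed.

(** The mass sits on the integers from 0 to n, so the symmetric partial sums are constant from m = n
    on and the limit exists in any normed space. *)
Lemma integ_sigma (V : normedModType R) (f : int -> V) n :
  integ f (sigma_meas n) = n.+1%:R^-1 *: \sum_(j < n.+1) f j%:Z.
Proof.
rewrite /integ; apply/cvg_lim => //; apply: cvg_near_cst; exists n => // m /= nm.
rewrite (eq_bigr (fun k : 'I_m.*2.+1 => n.+1%:R^-1 *: \sum_(j < n.+1) ((k%:Z - m%:Z == j%:Z)%:R *: f (k%:Z - m%:Z)))); last first.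
  by move=> k _; rewrite [X in X *: _]sigma_measE -scalerA scaler_suml.
rewrite -scaler_sumr exchange_big/=; congr (_ *: _).
apply: eq_bigr => j _.
(* The integer j sits at position m + j of the sum over [-m, m]. *)
have jm : (m + j < m.*2.+1)%N by rewrite -addnn ltnS leq_add2l (leq_trans _ nm)// -ltnS.
rewrite (bigD1 (Ordinal jm))//= PoszD [(m%:Z + _)%R]addrC addrK eqxx scale1r.
rewrite big1 ?addr0// => k kj; case: eqP => [kjm|]; last by rewrite scale0r.
by case/eqP: kj; apply/val_inj => /=; lia.
Qed.

Lemma bop_sumE (V : normedModType R) n (T : nat -> bop V) x :
  (\sum_(j < n) T j : bop V) x = \sum_(j < n) T j x.
Proof. by elim/big_rec2 : _ => //= j a b _ <-. Qed.

End classical_averages.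

(** * Transfer of equations *)

Section transfer.
Context {R : realType} {L : language}.
Implicit Types (M : structure R L) (G : seq (hsort (lsort L))).

Lemma sat_fapprox M G (p p' : formula G) : fapprox p p' ->
  forall e : htuple (carrier M) G, sat p e -> sat p' e.
Proof.
elim=> {G p p'} /=.
- by move=> G t r r' rr' e /le_trans; apply; rewrite ler_rat ltW.
- by move=> G t r r' rr' e; apply: le_trans; rewrite ler_rat ltW.
- by move=> G p p' q q' _ IHp _ IHq e [/IHp ? /IHq].
- by move=> G p p' q q' _ IHp _ IHq e [/IHp ?|/IHq ?]; [left|right].
- move=> G s r r' p p' rr' _ IH e [x [xr px]]; exists x; split; last exact: IH.
  by rewrite (le_trans xr)// ler_rat ltW.
- move=> G s r r' p p' rr' _ IH e h x xr; apply/IH/h.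
  by rewrite (lt_trans xr)// ltr_rat.
Qed.

(** One radius for all variables suffices, as an environment has finitely many entries. *)
Fixpoint close_all (r : rat) G : formula G -> sentence L :=
  match G with
  | [::] => id
  | s :: G' => fun p => close_all r (FAll r p)
  end.

Lemma sat_close_all M r G (p : formula G) :
  (forall e : htuple (carrier M) G, sat p e) -> sat (close_all r p) (tt : htuple (carrier M) [::]).
Proof.
elim: G p => [|s G IH] p h /=; first exact: h.
by apply: IH => e /= x _; exact: h.
Qed.

Lemma fapprox_close_all r r' G (p p' : formula G) : r' < r -> fapprox p p' ->
  fapprox (close_all r p) (close_all r' p').
Proof.
move=> rr'; elim: G p p' => [|s G IH] p p' pp' //=.
by apply: IH; constructor.
Qed.

Lemma close_all_sat M G (e : htuple (carrier M) G) :
  exists r0 : R, forall (r : rat) (p : formula G), r0 < ratr r ->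
    sat (close_all r p) (tt : htuple (carrier M) [::]) -> sat p e.
Proof.
elim: G e => [|s G IH] /= e; first by exists 0 => r p _; case: e.
case: e => x e; have [r0 hr0] := IH e.
exists (Num.max r0 (mdist (anchor M s) x)) => r p; rewrite gt_max => /andP[rr0 rx].
by move=> /(hr0 _ _ rr0)/(_ x rx).
Qed.

Lemma rat_above (a : R) : exists r : rat, a < ratr r.
Proof.
by exists (Num.bound `|a|)%:R; rewrite ratr_nat (le_lt_trans (ler_norm _))// archi_boundP.
Qed.

Lemma approx_close_all M G (p : formula G) :
  (forall r, approx_sat M (close_all r p)) ->
  forall (e : htuple (carrier M) G) p', fapprox p p' -> sat p' e.
Proof.
move=> h e p' pp'; have [r0 hr0] := close_all_sat e.
have [r rr0] := rat_above r0; apply: (hr0 r) => //.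
(* Approximating a universal quantifier shrinks its ball, so the closure of radius r + 1 yields the
   approximate one of radius r. *)
by apply: (h (r + 1)); apply: fapprox_close_all; rewrite // ltrDl.
Qed.

End transfer.

(** * Density of the rationals *)

Section rational_approximation.
Context {R : realType}.

Lemma le_ratr (a : R) (r : rat) :
  (forall r' : rat, r < r' -> a <= ratr r') -> a <= ratr r.
Proof.
move=> h; rewrite leNgt; apply/negP => /rat_in_itvoo[q].
by rewrite in_itv/= ltr_rat => /andP[/h]; rewrite leNgt => /negP hq /hq.
Qed.

Lemma ratr_le (a : R) (r : rat) :
  (forall r' : rat, r' < r -> ratr r' <= a) -> ratr r <= a.
Proof.
move=> h; rewrite -lerN2 -rmorphN; apply: le_ratr => r'.
by rewrite ltrNl => /h; rewrite rmorphN lerNl.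
Qed.

(** [F] is meant for an operation on the reals as interpreted in a model, uniformly continuous on
    bounded sets and known at rationals by transfer; [G] is the true operation. *)
Lemma eq_on_rationals (F G : R -> R -> R) :
  (forall r e : R, 0 < e -> exists2 d : R, 0 < d & forall a b a' b',
    `|a| <= r -> `|b| <= r -> `|a'| <= r -> `|b'| <= r ->
    `|a - a'| < d -> `|b - b'| < d -> `|F a b - F a' b'| < e) ->
  (forall a b e, 0 < e -> exists2 d : R, 0 < d & forall a' b',
    `|a - a'| < d -> `|b - b'| < d -> `|G a b - G a' b'| < e) ->
  (forall p r : rat, F (ratr p) (ratr r) = G (ratr p) (ratr r)) ->
  forall a b, F a b = G a b.
Proof.
move=> cF cG FG a b; apply/eqP; rewrite -subr_eq0 -normr_le0.
apply/ler_addgt0Pl => e e0; rewrite addr0.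
have e20 : 0 < e / 2 by rewrite divr_gt0.
(* The extra 1 keeps the rational approximations within the ball of radius [r]. *)
pose r := Num.max `|a| `|b| + 1.
have [d1 d10 hF] := cF r _ e20; have [d2 d20 hG] := cG a b _ e20.
pose d := Num.min 1 (Num.min d1 d2).
have d0 : 0 < d by rewrite !lt_min ltr01 d10.
have approx c : `|c| + 1 <= r -> exists2 p : rat,
    `|ratr p| <= r & `|c - ratr p| < d.
  move=> cr; have [|p] := @rat_in_itvoo R (c - d) c; first by rewrite gtrBl.
  rewrite in_itv/= => /andP[p1 p2].
  have pd : `|c - ratr p| < d by rewrite gtr0_norm ?subr_gt0// ltrBlDr addrC -ltrBlDr.
  exists p => //; apply: le_trans cr; rewrite -[ratr p](subrK c) addrC.
  rewrite (le_trans (ler_normD _ _))// lerD2l distrC (le_trans (ltW pd))//.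
  by rewrite ge_min lexx.
have ar : `|a| + 1 <= r by rewrite lerD2r le_max lexx.
have br : `|b| + 1 <= r by rewrite lerD2r le_max lexx orbT.
have [p pr ap] := approx _ ar; have [q qr bq] := approx _ br.
have d1d : d <= d1 by rewrite !ge_min lexx orbT.
have d2d : d <= d2 by rewrite !ge_min lexx !orbT.
rewrite -[F a b](subrK (F (ratr p) (ratr q))) {2}FG -addrA.
rewrite (le_trans (ler_normD _ _))// [leRHS]splitr lerD//; apply: ltW.
  apply: hF => //; [| |exact: lt_le_trans ap d1d|exact: lt_le_trans bq d1d].
    by rewrite (le_trans _ ar)// lerDl.
  by rewrite (le_trans _ br)// lerDl.
rewrite distrC; apply: hG; [exact: lt_le_trans ap d2d|exact: lt_le_trans bq d2d].
Qed.

End rational_approximation.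

(** * From classical to abstract PET structures *)

Section pet_transfer.
Context {R : realType} {M : structure R pet_lang} (hM : PET_structure M).

Lemma transfer_fapprox G (p : @formula pet_lang G) :
  (forall (H : hilbert R) (e : htuple (carrier (classical_PET H)) G), sat p e) ->
  forall (e : htuple (carrier M) G) p', fapprox p p' -> sat p' e.
Proof.
move=> h; apply: approx_close_all => r; apply: hM.2 => _ [H ->] p'.
by move=> /sat_fapprox; apply; apply: sat_close_all => e; exact: h.
Qed.

Lemma transfer_le G (t : @term pet_lang G sR) (r : rat) :
  (forall (H : hilbert R) (e : htuple (carrier (classical_PET H)) G),
    (Defs.eval e t : R) <= ratr r) ->
  forall e : htuple (carrier M) G, (Defs.eval e t : R) <= ratr r.
Proof.
move=> h e; apply: le_ratr => r' rr'.
exact: (@transfer_fapprox G (FLe t r) h e (FLe t r')) (approx_Le _ rr').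
Qed.

Lemma transfer_ge G (t : @term pet_lang G sR) (r : rat) :
  (forall (H : hilbert R) (e : htuple (carrier (classical_PET H)) G),
    ratr r <= (Defs.eval e t : R)) ->
  forall e : htuple (carrier M) G, ratr r <= (Defs.eval e t : R).
Proof.
move=> h e; apply: ratr_le => r' rr'.
exact: (@transfer_fapprox G (FGe t r) h e (FGe t r')) (approx_Ge _ rr').
Qed.

(** Atomic formulas are inequalities between reals, so an equation is expressed as [TDist t u] being
    at most 0. *)
Lemma transfer_eq G s (t u : @term pet_lang G s) :
  (forall (H : hilbert R) (e : htuple (carrier (classical_PET H)) G),
    Defs.eval e t = Defs.eval e u) ->
  forall e : htuple (carrier M) G, Defs.eval e t = Defs.eval e u.
Proof.
move=> h e; apply: mdist_positivity; apply/eqP.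
rewrite eq_le mdist_ge0 andbT -(rmorph0 (@ratr R)).
have := @transfer_le G (TDist t u) 0 _ e; apply=> H e' /=.
by rewrite h mdistxx rmorph0.
Qed.

End pet_transfer.

(** * Algebraic identities in a model *)

Section model_equations.
Notation app f ts := (@TApp pet_lang _ f ts).
Notation "t ,, ts" := (TCons t ts) (at level 60, right associativity).
Notation "()" := (TNil _).
Context {R : realType} {M : structure R pet_lang} (hM : PET_structure M).
Notation v0 := (TVar (Var0 _ _)).
Notation v1 := (TVar (VarS _ (Var0 _ _))).
Notation v2 := (TVar (VarS _ (VarS _ (Var0 _ _)))).
Notation cst c := (@TCst pet_lang _ c).

Definition addM (x y : carrier M sH) : carrier M sH :=
  @func_interp _ _ M (BanAdd BH) (x, (y, tt)).
Definition scaleM (a : R) (x : carrier M sH) : carrier M sH :=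
  @func_interp _ _ M (BanScale BH) (a : carrier M sR, (x, tt)).
Definition zeroM : carrier M sH := @const_interp _ _ M (CZero BH).
Definition innerM (x y : carrier M sH) : R :=
  @func_interp _ _ M HInner (x, (y, tt)).
Definition raddM (a b : R) : R :=
  @func_interp _ _ M RAdd (a : carrier M sR, (b : carrier M sR, tt)).
Definition rmulM (a b : R) : R :=
  @func_interp _ _ M RMul (a : carrier M sR, (b : carrier M sR, tt)).
Definition intM (i : int) : carrier M sZ := @const_interp _ _ M (CZ i).

(** A structure interprets the symbol [CR r] by some real number; the two sentences bounding it by r
    from above and below pin it down. *)
Lemma ratM (r : rat) : @const_interp _ _ M (CR r) = ratr r :> R.
Proof.
apply/eqP; rewrite eq_le; apply/andP; split.
  exact: (@transfer_le R M hM [::] (cst (CR r)) r (fun H e => lexx _) tt).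
exact: (@transfer_ge R M hM [::] (cst (CR r)) r (fun H e => lexx _) tt).
Qed.

Lemma raddM_rat (p r : rat) : raddM (ratr p) (ratr r) = ratr p + ratr r.
Proof.
have <- : ratr (p + r) = ratr p + ratr r :> R := rmorphD _ _ _.
rewrite -!ratM.
exact: (@transfer_eq R M hM [::] sR (app RAdd (cst (CR p),, cst (CR r),, ()))
  (cst (CR (p + r))) (fun H e => esym (rmorphD _ _ _)) tt).
Qed.

Lemma rmulM_rat (p r : rat) : rmulM (ratr p) (ratr r) = ratr p * ratr r.
Proof.
have <- : ratr (p * r) = ratr p * ratr r :> R := rmorphM _ _ _.
rewrite -!ratM.
exact: (@transfer_eq R M hM [::] sR (app RMul (cst (CR p),, cst (CR r),, ()))
  (cst (CR (p * r))) (fun H e => esym (rmorphM _ _ _)) tt).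
Qed.

(** The symbol [RAdd] too is a priori interpreted by any function; its value on rationals and its
    uniform continuity on bounded sets determine it. *)
Lemma raddME a b : raddM a b = a + b.
Proof.
apply: (@eq_on_rationals _ raddM +%R) => [r e e0|{}a {}b e e0|p r].
- have [_ /(_ e e0)[d d0 hd]] := hM.1 RAdd r; exists d => // a0 b0 a1 b1.
  move=> a0r b0r a1r b1r h0 h1; rewrite distrC.
  apply: (hd (a0, (b0, tt)) (a1, (b1, tt))).
  - by rewrite /= /mdist/= !subr0.
  - by rewrite /= /mdist/= !subr0.
  - by rewrite /= /mdist/= distrC (distrC b1).
- exists (e / 2); first by rewrite divr_gt0.
  move=> a1 b1 h1 h2; rewrite opprD addrACA (le_lt_trans (ler_normD _ _))//.
  by rewrite [e]splitr ltrD.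
- exact: raddM_rat.
Qed.

Lemma rmulME a b : rmulM a b = a * b.
Proof.
apply: (@eq_on_rationals _ rmulM *%R) => [r e e0|{}a {}b e e0|p r].
- have [_ /(_ e e0)[d d0 hd]] := hM.1 RMul r; exists d => // a0 b0 a1 b1.
  move=> a0r b0r a1r b1r h0 h1; rewrite distrC.
  apply: (hd (a0, (b0, tt)) (a1, (b1, tt))).
  - by rewrite /= /mdist/= !subr0.
  - by rewrite /= /mdist/= !subr0.
  - by rewrite /= /mdist/= distrC (distrC b1).
- pose D := `|a| + `|b| + 1.
  have D0 : 0 < D by rewrite ltr_wpDl// addr_ge0.
  exists (Num.min 1 (e / D)); first by rewrite lt_min ltr01 divr_gt0.
  move=> a1 b1; rewrite !lt_min => /andP[h1 h1'] /andP[h2 h2'].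
  have -> : a * b - a1 * b1 = (a - a1) * b1 + a * (b - b1) by ring.
  rewrite (le_lt_trans (ler_normD _ _))// !normrM.
  have b1D : `|b1| <= `|b| + 1.
    rewrite -[b1](subrK b) (le_trans (ler_normD _ _))// addrC lerD2l distrC.
    exact: ltW.
  apply: (@le_lt_trans _ _ (`|a - a1| * (`|b| + 1) + `|a| * (e / D))).
    by rewrite lerD ?ler_wpM2l// ltW.
  apply: (@lt_le_trans _ _ (e / D * (`|b| + 1) + `|a| * (e / D))).
    by rewrite ltrD2r ltr_pM2r// ltr_wpDl.
  by rewrite [`|a| * _]mulrC -mulrDr addrC addrA -/D divfK// gt_eqF.
- exact: rmulM_rat.
Qed.

Lemma addMA x y z : addM x (addM y z) = addM (addM x y) z.
Proof.
exact: (@transfer_eq R M hM [:: sH; sH; sH] sH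
  (app (BanAdd BH) (v0,, app (BanAdd BH) (v1,, v2,, ()),, ()))
  (app (BanAdd BH) (app (BanAdd BH) (v0,, v1,, ()),, v2,, ()))
  (fun H e => addrA _ _ _) (x, (y, (z, tt)))).
Qed.

Lemma addMC x y : addM x y = addM y x.
Proof.
exact: (@transfer_eq R M hM [:: sH; sH] sH
  (app (BanAdd BH) (v0,, v1,, ())) (app (BanAdd BH) (v1,, v0,, ()))
  (fun H e => addrC _ _) (x, (y, tt))).
Qed.

Lemma add0M x : addM zeroM x = x.
Proof.
exact: (@transfer_eq R M hM [:: sH] sH
  (app (BanAdd BH) (cst (CZero BH),, v0,, ())) v0
  (fun H e => add0r _) (x, tt)).
Qed.

(** Banach sorts have no symbol for the opposite, hence scaling by -1. *)
Lemma addNM x : addM (scaleM (-1) x) x = zeroM.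
Proof.
have <- : @const_interp _ _ M (CR (-1)) = -1 :> R by rewrite ratM rmorphN1.
apply: (@transfer_eq R M hM [:: sH] sH
  (app (BanAdd BH) (app (BanScale BH) (cst (CR (-1)),, v0,, ()),, v0,, ()))
  (cst (CZero BH)) _ (x, tt)) => H e.
by rewrite /= /classical_func /ap2/= rmorphN1 scaleN1r addNr.
Qed.

Lemma scaleMA a b x : scaleM a (scaleM b x) = scaleM (a * b) x.
Proof.
rewrite -rmulME.
exact: (@transfer_eq R M hM [:: sR; sR; sH] sH
  (app (BanScale BH) (v0,, app (BanScale BH) (v1,, v2,, ()),, ()))
  (app (BanScale BH) (app RMul (v0,, v1,, ()),, v2,, ()))
  (fun H e => scalerA _ _ _) (a, (b, (x, tt)))).
Qed.

Lemma scale1M x : scaleM 1 x = x.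
Proof.
have <- : @const_interp _ _ M (CR 1) = 1 :> R by rewrite ratM rmorph1.
apply: (@transfer_eq R M hM [:: sH] sH
  (app (BanScale BH) (cst (CR 1),, v0,, ())) v0 _ (x, tt)) => H e.
by rewrite /= /classical_func /ap2/= rmorph1 scale1r.
Qed.

Lemma scaleMDr a x y : scaleM a (addM x y) = addM (scaleM a x) (scaleM a y).
Proof.
exact: (@transfer_eq R M hM [:: sR; sH; sH] sH
  (app (BanScale BH) (v0,, app (BanAdd BH) (v1,, v2,, ()),, ()))
  (app (BanAdd BH) (app (BanScale BH) (v0,, v1,, ()),,
                    app (BanScale BH) (v0,, v2,, ()),, ()))
  (fun H e => scalerDr _ _ _) (a, (x, (y, tt)))).
Qed.

Lemma scaleMDl x a b : scaleM (a + b) x = addM (scaleM a x) (scaleM b x).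
Proof.
rewrite -raddME.
exact: (@transfer_eq R M hM [:: sR; sR; sH] sH
  (app (BanScale BH) (app RAdd (v0,, v1,, ()),, v2,, ()))
  (app (BanAdd BH) (app (BanScale BH) (v0,, v2,, ()),,
                    app (BanScale BH) (v1,, v2,, ()),, ()))
  (fun H e => scalerDl _ _ _) (a, (b, (x, tt)))).
Qed.

Lemma innerMC x y : innerM x y = innerM y x.
Proof.
exact: (@transfer_eq R M hM [:: sH; sH] sR
  (app HInner (v0,, v1,, ())) (app HInner (v1,, v0,, ()))
  (fun H e => innerC _ _) (x, (y, tt))).
Qed.

Lemma innerMDl x y z : innerM (addM x y) z = innerM x z + innerM y z.
Proof.
rewrite -raddME.
exact: (@transfer_eq R M hM [:: sH; sH; sH] sR
  (app HInner (app (BanAdd BH) (v0,, v1,, ()),, v2,, ()))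
  (app RAdd (app HInner (v0,, v2,, ()),, app HInner (v1,, v2,, ()),, ()))
  (fun H e => innerDl _ _ _) (x, (y, (z, tt)))).
Qed.

Lemma innerMZl a x y : innerM (scaleM a x) y = a * innerM x y.
Proof.
rewrite -rmulME.
exact: (@transfer_eq R M hM [:: sR; sH; sH] sR
  (app HInner (app (BanScale BH) (v0,, v1,, ()),, v2,, ()))
  (app RMul (v0,, app HInner (v1,, v2,, ()),, ()))
  (fun H e => innerZl _ _ _) (a, (x, (y, tt)))).
Qed.

(** This ties the metric of the sort to its inner product, so that a Cauchy estimate for the latter
    is one for the former. *)
Lemma mdistM2 x y : mdist x y ^+ 2 =
  innerM (addM x (scaleM (-1) y)) (addM x (scaleM (-1) y)).
Proof.
have <- : @const_interp _ _ M (CR (-1)) = -1 :> R by rewrite ratM rmorphN1.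
rewrite expr2 -rmulME.
pose d := app (BanAdd BH) (v0,, app (BanScale BH) (cst (CR (-1)),, v1,, ()),, ())
  : @term pet_lang [:: sH; sH] sH.
apply: (@transfer_eq R M hM [:: sH; sH] sR
  (app RMul (TDist v0 v1,, TDist v0 v1,, ())) (app HInner (d,, d,, ()))
  _ (x, (y, tt))) => H [x' [y' []]].
rewrite /= /classical_func /ap2/= rmorphN1 scaleN1r inner_norm -expr2.
by rewrite distrC.
Qed.

Lemma innerM_ge0 x : 0 <= innerM x x.
Proof.
have -> : innerM x x = rmulM (mdist x zeroM) (mdist x zeroM).
  apply: (@transfer_eq R M hM [:: sH] sR (app HInner (v0,, v0,, ()))
    (app RMul (TDist v0 (cst (CZero BH)),, TDist v0 (cst (CZero BH)),, ()))
    _ (x, tt)) => H [x' []].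
  by rewrite /= /classical_func /ap2/= inner_norm -expr2 /mdist/= sub0r normrN.
by rewrite rmulME -expr2 sqr_ge0.
Qed.

Lemma evalBD (S : carrier M sB) x y :
  evalB S (addM x y) = addM (evalB S x) (evalB S y).
Proof.
exact: (@transfer_eq R M hM [:: sB; sH; sH] sH
  (app BEval (v0,, app (BanAdd BH) (v1,, v2,, ()),, ()))
  (app (BanAdd BH) (app BEval (v0,, v1,, ()),, app BEval (v0,, v2,, ()),, ()))
  (fun H e => bopD _ _ _) (S, (x, (y, tt)))).
Qed.

Lemma evalBZ (S : carrier M sB) a x :
  evalB S (scaleM a x) = scaleM a (evalB S x).
Proof.
exact: (@transfer_eq R M hM [:: sB; sR; sH] sH
  (app BEval (v0,, app (BanScale BH) (v1,, v2,, ()),, ()))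
  (app (BanScale BH) (v1,, app BEval (v0,, v2,, ()),, ()))
  (fun H e => bopZ _ _ _) (S, (a, (x, tt)))).
Qed.

Lemma evalB_id x : evalB (idB M) x = x.
Proof.
exact: (@transfer_eq R M hM [:: sH] sH (app BEval (cst CId,, v0,, ())) v0
  (fun H e => erefl) (x, tt)).
Qed.

Lemma evalB_comp (S T : carrier M sB) x :
  evalB (compB S T) x = evalB S (evalB T x).
Proof.
exact: (@transfer_eq R M hM [:: sB; sB; sH] sH
  (app BEval (app BComp (v0,, v1,, ()),, v2,, ()))
  (app BEval (v0,, app BEval (v1,, v2,, ()),, ()))
  (fun H e => erefl) (S, (T, (x, tt)))).
Qed.

Lemma evalB_adj (S : carrier M sB) x y :
  innerM (evalB S x) y = innerM x (evalB (adjB S) y).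
Proof.
exact: (@transfer_eq R M hM [:: sB; sH; sH] sR
  (app HInner (app BEval (v0,, v1,, ()),, v2,, ()))
  (app HInner (v1,, app BEval (app BAdj (v0,, ()),, v2,, ()),, ()))
  (fun H e => adjP _ _ _) (S, (x, (y, tt)))).
Qed.

Lemma addZ_int i j : addZ (intM i) (intM j) = intM (i + j).
Proof.
exact: (@transfer_eq R M hM [::] sZ (app ZAdd (cst (CZ i),, cst (CZ j),, ()))
  (cst (CZ (i + j))) (fun H e => erefl) tt).
Qed.

End model_equations.

(** The alias mentions [hM] because the vector space laws attached to it are proved from [hM]. *)
Definition Hspace (R : realType) (M : structure R pet_lang)
  (hM : PET_structure M) : Type := carrier M sH.

(** * The sort H as an inner product space, with its unitaries and averages *)

Section Hspace.
Context {R : realType} {M : structure R pet_lang} (hM : PET_structure M).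

HB.instance Definition _ := Choice.copy (Hspace hM) (carrier M sH).
HB.instance Definition _ := GRing.isZmodule.Build (Hspace hM)
  (addMA hM) (addMC hM) (add0M hM) (addNM hM).
HB.instance Definition _ := GRing.Zmodule_isLmodule.Build R (Hspace hM)
  (scaleMA hM) (scale1M hM) (scaleMDr hM) (scaleMDl hM).

Definition ipM : semi_inner (Hspace hM) := @SemiInner _ (Hspace hM) innerM
  (innerMC hM) (innerMDl hM) (innerMZl hM) (innerM_ge0 hM).

Lemma mdist_sqn (x y : Hspace hM) :
  mdist (x : carrier M sH) y ^+ 2 = sqn ipM (x - y).
Proof. exact: mdistM2. Qed.

Lemma sqn_eq0 (x : Hspace hM) : sqn ipM x = 0 -> x = 0.
Proof.
rewrite -[x in sqn _ x]subr0 -mdist_sqn => /eqP; rewrite sqrf_eq0 => /eqP.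
exact: mdist_positivity.
Qed.

Definition represents (S : carrier M sB) (U : unitary ipM) : Prop :=
  forall x : Hspace hM, evalB S x = U x :> Hspace hM.

(** The difference w of the two sides is orthogonal to itself: moving S and U to the left factor
    turns q(w) into the difference of the products of S w and U w with y. Definiteness then gives w
    = 0. *)
Lemma represents_adj S U : represents S U ->
  forall y : Hspace hM, evalB (adjB S) y = uinv U y :> Hspace hM.
Proof.
move=> SU y; apply/eqP; rewrite -subr_eq0; apply/eqP/sqn_eq0.
set w : Hspace hM := _ - _; rewrite /sqn {2}/w ipDr ipNr.
rewrite -uf_adj -[U w]SU; apply/eqP; rewrite subr_eq0; apply/eqP.
by rewrite [RHS](evalB_adj hM).
Qed.

Lemma represents_div S S' U U' : represents S U -> represents S' U' ->
  represents (compB S (adjB S')) (udiv U U').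
Proof.
by move=> SU SU' x; rewrite (evalB_comp hM) (represents_adj SU') SU.
Qed.

Section unitary_of_model.
Context (S : carrier M sB).
Context (hS : compB (adjB S) S = idB M /\ compB S (adjB S) = idB M).

Let fK : cancel (evalB S) (evalB (adjB S)).
Proof. by move=> x; rewrite -(evalB_comp hM) hS.1 (evalB_id hM). Qed.

Let Kf : cancel (evalB (adjB S)) (evalB S).
Proof. by move=> x; rewrite -(evalB_comp hM) hS.2 (evalB_id hM). Qed.

Let f_ip (x y : Hspace hM) : ipM (evalB S x) (evalB S y) = ipM x y.
Proof. by rewrite [LHS](evalB_adj hM) fK. Qed.

Definition unitary_of : unitary ipM := @Unitary _ (Hspace hM) ipM
  (evalB S) (evalB (adjB S)) (evalBD hM S) (evalBZ hM S) fK Kf f_ip.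

End unitary_of_model.

(** [foldl] applies the head of the list first, like the outermost shift in [uleibman], so a list of
    d standard integers matches d levels of the recursion. *)
Lemma uleibman_of_model d (T : carrier M sZ -> carrier M sB)
    (U : int -> unitary ipM) : (forall j, represents (T (intM j)) (U j)) ->
  (forall s : seq int, size s = d -> forall j,
    foldl (fun f i => Delta i f) T (map intM s) (intM j) = idB M) ->
  uleibman d U.
Proof.
elim: d T U => [|d IH] T U TU hT /=.
  move=> j x; rewrite -TU.
  by have /= -> := hT [::] erefl j; rewrite (evalB_id hM).
move=> i; apply: (IH (Delta (intM i) T)).
  move=> j; rewrite /Delta (addZ_int hM); exact: represents_div.
by move=> s sd j; apply: (hT (i :: s)); rewrite /= sd.
Qed.

Notation app f ts := (@TApp pet_lang _ f ts).
Notation "t ,, ts" := (TCons t ts) (at level 60, right associativity).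
Notation "()" := (TNil _).
Notation cst c := (@TCst pet_lang _ c).
Notation v0 := (TVar (Var0 _ _)).
Notation v1 := (TVar (VarS _ (Var0 _ _))).

(** For each standard n the sum of the T_k x over k < n is a term in T and x, so the formula for the
    n-th average becomes an equation, transferred for each n separately. *)
Definition orbit_term (k : nat) : @term pet_lang [:: sL DZ VB; sH] sH :=
  app BEval (app (LEval1 VB) (v0,, cst (CZ k%:Z),, ()),, v1,, ()).

Fixpoint orbit_sum (n : nat) : @term pet_lang [:: sL DZ VB; sH] sH :=
  if n is n'.+1 then app (BanAdd BH) (orbit_sum n',, orbit_term n',, ())
  else cst (CZero BH).

Lemma evalB_AV (T : carrier M (sL DZ VB)) n (x : Hspace hM) :
  evalB (AV (stdN M n) T) x =
  avg n (fun k => evalB (evalL T (intM k%:Z)) x : Hspace hM) :> Hspace hM.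
Proof.
have sumE m : Defs.eval ((T, (x, tt)) : htuple (carrier M) [:: sL DZ VB; sH])
    (orbit_sum m) = \sum_(k < m) (evalB (evalL T (intM k%:Z)) x : Hspace hM).
  elim: m => [|m IH]; first by rewrite big_ord0.
  by rewrite big_ord_recr -IH.
rewrite /avg -sumE.
have <- : @const_interp _ _ M (CR n.+1%:R^-1) = n.+1%:R^-1 :> R.
  by rewrite (ratM hM) fmorphV rmorph_nat.
apply: (@transfer_eq R M hM [:: sL DZ VB; sH] sH
  (app BEval (app (Int VB) (v0,, app Sigma (cst (CN n),, ()),, ()),, v1,, ()))
  (app (BanScale BH) (cst (CR n.+1%:R^-1),, orbit_sum n.+1,, ()))
  _ (T, (x, tt))) => H [T' [x' []]].
have sumE' m : Defs.eval ((T', (x', tt)) :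
    htuple (carrier (classical_PET H)) [:: sL DZ VB; sH])
    (orbit_sum m) = \sum_(k < m) (T' : linf int (bop H)) k%:Z x'.
  elim: m => [|m IH]; first by rewrite big_ord0.
  by rewrite big_ord_recr/= -IH.
transitivity ((n.+1%:R^-1 : R) *: \sum_(k < n.+1) (T' : linf int (bop H)) k%:Z x').
  rewrite -(bop_sumE n.+1 (fun k : nat => (T' : linf int (bop H)) k%:Z)).
  exact: (congr1 (fun S : bop H => S x') (integ_sigma _ _)).
have <- : ratr n.+1%:R^-1 = n.+1%:R^-1 :> R by rewrite fmorphV rmorph_nat.
by rewrite -sumE'.
Qed.

End Hspace.

(** * Convergence along the standard integers *)

Theorem theorem2 (R : realType) (M : structure R pet_lang)
    (hM : PET_structure M) (hH : complete_sort M sH)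
    (T : carrier M (sL DZ VB)) (hT : unitary_leibman T) (x : carrier M sH) :
  exists y : carrier M sH,
    (fun n : nat => evalB (AV (stdN M n) T) x) @ \oo --> y.
Proof.
have [d [uT lT]] := hT.
pose U (j : int) : unitary (ipM hM) := unitary_of hM (uT (intM j)).
(* Degree at most d means that d + 1 differences give the identity, hence [d.+1]. *)
have lU : uleibman d.+1 U.
  apply: (@uleibman_of_model _ _ hM _ (evalL T)) => // s sd j.
  have smap : size (map (@intM R M) s) == d.+1 by rewrite size_map sd.
  exact: (lT (Tuple smap)).
(* Halving the square turns the nonstrict bound of [uleibman_cauchy] into the strict one of a
   ball. *)
have e2 (e : R) : 0 < e -> 0 < e ^+ 2 / 2 by move=> e0; rewrite divr_gt0// exprn_gt0.
apply: hH; apply: cauchy_sequence => e e0.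
have [N0 hN0] := uleibman_cauchy (x : Hspace hM) lU (e2 _ e0).
exists N0 => N N0N; rewrite ballEmdist/= -(@ltr_pXn2r _ 2)// ?nnegrE ?mdist_ge0// ?(ltW e0)//.
rewrite (mdist_sqn (hM := hM)) !(@evalB_AV _ _ hM).
apply: le_lt_trans (hN0 _ _ (leqnn _) N0N) _.
by rewrite ltr_pdivrMr// ltr_pMr ?ltr1n// exprn_gt0.
Qed.
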